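(* Let $\overline F=e^{\phi}F$ be an anisotropic conformal transformation of a conic pseudo-Finsler surface $(M,F)$. Then: (i) If $F$ is a Landsberg metric and the transformation satisfies the anisotropic $\phi T$-condition, provided that $m^i\partial_i\phi\neq0$, then $F$ is Berwaldian. (ii) If $(M,\overline F)$ is a Landsberg surface and the transformation satisfies the anisotropic $\phi\overline T$-condition, provided that $m^i\partial_i\phi\neq\varepsilon\phi_{;2}\ell^i\partial_i\phi$, then $(M,\overline F)$ is Berwaldian. In other words, a non-Riemannian Landsberg surface $(M,\overline F)$ is Berwaldian if the anisotropic $\phi\overline T$-condition is satisfied, provided that the transformation is not a $\overline C$-anisotropic conformal change.
   Context: $M$ is a smooth 2-dimensional manifold with local coordinates $(x^i)$ and induced coordinates $(x^i,y^i)$ on $TM$; $\partial_i=\partial/\partial x^i$, $\dot\partial_i=\partial/\partial y^i$. $\mathcal A\subset TM_0=TM\setminus(0)$ is a conic sub-bundle (non-empty, open, invariant under $y\mapsto\lambda y$, $\lambda>0$, projecting onto $M$). A function is $h(r)$ if it is positively homogeneous of degree $r$ in $y$. A conic pseudo-Finsler metric is a smooth $h(1)$ function $F:\mathcal A\to\mathbb R$ with $g_{ij}=\frac12\dot\partial_i\dot\partial_jF^2$ non-degenerate. Modified Berwald frame: $\ell_i=\dot\partial_iF$, $\ell^i=y^i/F$, $g_{ij}=\ell_i\ell_j+\varepsilon m_im_j$ with $\varepsilon=\pm1$, $m^i=g^{ij}m_j$. Spray coefficients: $G^i=\frac14g^{ik}(y^m\partial_m\dot\partial_kF^2-\partial_kF^2)$;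 $G^j_i=\dot\partial_iG^j$; $\delta_i=\partial_i-G^j_i\dot\partial_j$. The main scalar $\mathcal I$ is defined by $FC_{ijk}=\mathcal I m_im_jm_k$, where $C_{ijk}=\frac12\dot\partial_kg_{ij}$; $C^i_{jk}=g^{ir}C_{rjk}$; $F$ is Riemannian iff $\mathcal I=0$. For smooth $f$ on $\mathcal A$: $F\dot\partial_if=f_{;1}\ell_i+f_{;2}m_i$, $\delta_if=f_{,1}\ell_i+f_{,2}m_i$. The $T$-tensor of $F$ is given by $FT_{ijkh}=\mathcal I_{;2}m_im_jm_km_h$, and $T^i_{jkr}=g^{ih}T_{hjkr}$, i.e. $FT^i_{jkr}=\mathcal I_{;2}m^im_jm_km_r$. An anisotropic conformal transformation of $F$ is $\overline F=e^{\phi(x,y)}F$ with $\phi$ a smooth $h(0)$ function on $\mathcal A$ such that $\varepsilon+\sigma-(\phi_{;2})^2\ne0$, where $\sigma=\phi_{;2;2}+\varepsilon\mathcal I\phi_{;2}+2(\phi_{;2})^2$; $\rho=\frac{1}{\sigma+\varepsilon-(\phi_{;2})^2}$. It is proper if $\phi_{;2}\neq0$. Bars denote objects associated with $\overline F$; the frame of $\overline F$ is taken with the same sign $\varepsilon$, $\overline m_i=e^{\phi}\sqrt{\varepsilon/\rho}\,m_i$. The change satisfies the anisotropic $\phi T$-condition if $(\partial_i\phi)T^i_{jkr}=0$, and the anisotropic $\phi\overline T$-condition if $(\partial_i\phi)\overline T^i_{jkr}=0$. A proper change is $\overline C$-anisotropic conformal if $\overline C^i_{jk}\partial_i\phi=0$.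 $F$ is Landsberg iff $\mathcal I_{,1}=0$ and Berwaldian iff $\mathcal I_{,1}=\mathcal I_{,2}=0$; likewise for $\overline F$ with $\overline{\mathcal I}$ and the horizontal scalar derivatives of $\overline F$. *)

(* Defs.v *)
From HB Require Import structures.
From mathcomp Require Import all_boot all_order all_algebra.
From mathcomp Require Import all_classical all_reals all_analysis.

Set Implicit Arguments.
Unset Strict Implicit.
Unset Printing Implicit Defensive.
Import Order.TTheory GRing.Theory Num.Theory.
Import numFieldNormedType.Exports.
Local Open Scope classical_set_scope.
Local Open Scope ring_scope.

(* [f] is C^oo on the open set [U]: [f] and all its iterated directional
   derivatives are differentiable at every point of [U]. *)
Fixpoint Cn_on (R : realType) (V W : normedModType R) (n : nat) (U : set V)
    (f : V -> W) : Prop :=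
  match n with
  | 0 => {in U, continuous f}
  | k.+1 => (forall x, U x -> differentiable f x) /\
            (forall v : V, Cn_on k U ('D_v f))
  end.

Definition smooth_on (R : realType) (V W : normedModType R) (U : set V)
    (f : V -> W) : Prop := forall n, Cn_on n U f.

(* A smooth surface, given by a C^oo atlas (not necessarily maximal).
   [chart_inv a] is only meaningful on [chart a @` chart_dom a]. *)
Record smooth_surface (R : realType) := SmoothSurface {
  surface_space :> topologicalType;
  surface_hausdorff : hausdorff_space surface_space;
  surface_second_countable : @second_countable surface_space;
  chart_idx : Type;
  chart_dom : chart_idx -> set surface_space;
  chart : chart_idx -> surface_space -> 'rV[R]_2;
  chart_inv : chart_idx -> 'rV[R]_2 -> surface_space;
  chart_dom_open : forall a, open (chart_dom a);
  chart_dom_cover : forall p, exists a, chart_dom a p;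
  chart_img_open : forall a, open (chart a @` chart_dom a);
  chartK : forall a p, chart_dom a p -> chart_inv a (chart a p) = p;
  chart_continuous : forall a, {in chart_dom a, continuous (chart a)};
  chart_inv_continuous :
    forall a, {in chart a @` chart_dom a, continuous (chart_inv a)};
  transition_smooth : forall a b,
    smooth_on (chart a @` (chart_dom a `&` chart_dom b))
              (chart b \o chart_inv a)
}.

(* A tangent vector at [tv_pt] is a contravariant family of components, one
   for every chart around the base point; components in the other charts are
   set to 0, so that tangent vectors are equal iff they have the same base
   point and the same components. *)
Record tvec (R : realType) (M : smooth_surface R) := TVec {
  tv_pt : M;
  tv_comp : chart_idx M -> 'rV[R]_2;
  tv_change : forall a b, chart_dom a tv_pt -> chart_dom b tv_pt ->
    tv_comp b = 'd (chart b \o chart_inv a) (chart a tv_pt) (tv_comp a);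
  tv_out : forall a, ~ chart_dom a tv_pt -> tv_comp a = 0
}.

Lemma near_diff_comp (R : realType) (U V W : normedModType R) (f : U -> V)
    (g : V -> W) (h : U -> W) (x v : U) (z : V) :
  f x = z -> differentiable f x -> differentiable g z -> differentiable h x ->
  (\forall u \near x, h u = g (f u)) ->
  'd h x v = 'd g z ('d f x v).
Proof.
move=> <- Df Dg Dh fgh.
have <- : 'd (g \o f) x v = 'd g (f x) ('d f x v) by rewrite diff_comp.
rewrite -!deriveE //; last exact: differentiable_comp.
have [->|v0] := eqVneq v 0; first by rewrite !derive0.
exact: near_eq_derive.
Qed.

Section TangentVectors.
Variables (R : realType) (M : smooth_surface R).

Lemma transition_differentiable (a b : chart_idx M) (p : M) :
  chart_dom a p -> chart_dom b p ->
  differentiable (chart b \o chart_inv a) (chart a p).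
Proof.
by move=> pa pb; have [+ _] := transition_smooth a b 1; apply; exists p.
Qed.

Lemma transition_comp (a b c : chart_idx M) (p : M) (v : 'rV[R]_2) :
  chart_dom a p -> chart_dom b p -> chart_dom c p ->
  'd (chart c \o chart_inv a) (chart a p) v =
  'd (chart c \o chart_inv b) (chart b p)
    ('d (chart b \o chart_inv a) (chart a p) v).
Proof.
move=> pa pb pc.
apply: (@near_diff_comp R _ _ _ (chart b \o chart_inv a)
  (chart c \o chart_inv b) (chart c \o chart_inv a)).
- by rewrite /= chartK.
- exact: transition_differentiable.
- exact: transition_differentiable.
- exact: transition_differentiable.
have cont : {for chart a p, continuous (chart_inv a)}.
  by apply: (@chart_inv_continuous _ M a); rewrite inE; exists p.
have nb : nbhs (chart_inv a (chart a p)) (chart_dom b).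
  by rewrite chartK //; apply: open_nbhs_nbhs; split=> //; exact: chart_dom_open.
have nba : nbhs (chart a p) [set u | chart_dom b (chart_inv a u)] := cont _ nb.
by near=> u; rewrite /= chartK //; near: u; exact: nba.
Unshelve. all: by end_near.
Qed.

(* The tangent vector at [p] with components [y] in the chart [a]. *)
Definition tv_of_comp (a : chart_idx M) (p : M) (y : 'rV[R]_2)
    (b : chart_idx M) : 'rV[R]_2 :=
  if `[< chart_dom a p /\ chart_dom b p >]
  then 'd (chart b \o chart_inv a) (chart a p) y else 0.

Lemma tv_of_change (a : chart_idx M) (p : M) (y : 'rV[R]_2) b c :
  chart_dom b p -> chart_dom c p ->
  tv_of_comp a p y c =
  'd (chart c \o chart_inv b) (chart b p) (tv_of_comp a p y b).
Proof.
move=> pb pc; rewrite /tv_of_comp.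
have [pa|npa] := pselect (chart_dom a p).
  by rewrite !asboolT //; apply: transition_comp.
by rewrite !asboolF ?linear0 //; case.
Qed.

Lemma tv_of_out (a : chart_idx M) (p : M) (y : 'rV[R]_2) b :
  ~ chart_dom b p -> tv_of_comp a p y b = 0.
Proof. by move=> npb; rewrite /tv_of_comp asboolF //; case. Qed.

Definition tv_of (a : chart_idx M) (p : M) (y : 'rV[R]_2) : tvec M :=
  @TVec R M p (tv_of_comp a p y) (@tv_of_change a p y) (@tv_of_out a p y).

Lemma tv_scale_change (l : R) (v : tvec M) a b :
  chart_dom a (tv_pt v) -> chart_dom b (tv_pt v) ->
  l *: tv_comp v b =
  'd (chart b \o chart_inv a) (chart a (tv_pt v)) (l *: tv_comp v a).
Proof. by move=> va vb; rewrite linearZ /= -tv_change. Qed.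

Lemma tv_scale_out (l : R) (v : tvec M) a :
  ~ chart_dom a (tv_pt v) -> l *: tv_comp v a = 0.
Proof. by move=> va; rewrite tv_out // scaler0. Qed.

Definition tv_scale (l : R) (v : tvec M) : tvec M :=
  @TVec R M (tv_pt v) (fun a => l *: tv_comp v a)
    (@tv_scale_change l v) (@tv_scale_out l v).

(* Points [(x, y)] of the coordinate space carry the induced coordinates
   (x^i, y^i) of TM. *)
Definition tv_param (a : chart_idx M) (p : 'rV[R]_2 * 'rV[R]_2) : tvec M :=
  tv_of a (chart_inv a p.1) p.2.

Definition local_fun (f : tvec M -> R) (a : chart_idx M)
  : 'rV[R]_2 * 'rV[R]_2 -> R := f \o tv_param a.

Definition local_dom (A : set (tvec M)) (a : chart_idx M)
  : set ('rV[R]_2 * 'rV[R]_2) :=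
  [set p | (chart a @` chart_dom a) p.1 /\ A (tv_param a p)].

Record conic_subbundle (A : set (tvec M)) : Prop := ConicSubbundle {
  conic_nonempty : A !=set0;
  conic_open : forall a, open (local_dom A a);
  conic_neq0 : forall v, A v -> exists a, tv_comp v a != 0;
  conic_scale : forall v (l : R), 0 < l -> A v -> A (tv_scale l v);
  conic_onto : forall p : M, exists2 v, A v & tv_pt v = p
}.

Definition smooth_fun (A : set (tvec M)) (f : tvec M -> R) : Prop :=
  forall a, smooth_on (local_dom A a) (local_fun f a).

Definition homogeneous_fun (A : set (tvec M)) (r : nat) (f : tvec M -> R) :=
  forall v (l : R), A v -> 0 < l -> f (tv_scale l v) = l ^+ r * f v.

End TangentVectors.

(* Local Finsler calculus: [L] is the expression of the metric F in induced
   coordinates and [m i] are the components m_i of the frame covector. *)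
Section LocalCalculus.
Variable R : realType.
Local Notation E := ('rV[R]_2 * 'rV[R]_2)%type.
Implicit Types (f L : E -> R) (m : 'I_2 -> E -> R) (p : E) (i j k h : 'I_2).

Definition dx i f : E -> R :=
  'D_((delta_mx 0 i : 'rV[R]_2, 0 : 'rV[R]_2) : E) f.
Definition dy i f : E -> R :=
  'D_((0 : 'rV[R]_2, delta_mx 0 i : 'rV[R]_2) : E) f.

Definition yc i p : R := p.2 0 i.
Definition sqrF L : E -> R := fun p => L p ^+ 2.

Definition g_lo L i j : E -> R := fun p => 2^-1 * dy i (dy j (sqrF L)) p.
Definition g_mx L p : 'M[R]_2 := \matrix_(i, j) g_lo L i j p.
Definition g_up L i j : E -> R := fun p => invmx (g_mx L p) i j.

Definition ell_lo L i : E -> R := dy i L.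
Definition ell_up L i : E -> R := fun p => yc i p / L p.
Definition m_up L m i : E -> R := fun p => \sum_j g_up L i j p * m j p.

Definition spray L i : E -> R := fun p =>
  4^-1 * \sum_k g_up L i k p *
    (\sum_h yc h p * dx h (dy k (sqrF L)) p - dx k (sqrF L) p).
(* [barthel L i j] is G^j_i *)
Definition barthel L i j : E -> R := dy i (spray L j).
Definition delta L i f : E -> R := fun p =>
  dx i f p - \sum_j barthel L i j p * dy j f p.

Definition C_lo L i j k : E -> R := fun p => 2^-1 * dy k (g_lo L i j) p.
Definition C_up L i j k : E -> R := fun p =>
  \sum_h g_up L i h p * C_lo L h j k p.

(* The main scalar and the scalar derivatives are the numbers characterized by
   the displayed equations; they exist and are unique wherever [m] completes
   ell_i to a modified Berwald frame. *)
Definition main_scalar L m : E -> R := fun p =>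
  get [set s : R | forall i j k,
    L p * C_lo L i j k p = s * m i p * m j p * m k p].
Definition vder L m f : E -> R * R := fun p =>
  get [set s : R * R | forall i,
    L p * dy i f p = s.1 * ell_lo L i p + s.2 * m i p].
Definition hder L m f : E -> R * R := fun p =>
  get [set s : R * R | forall i,
    delta L i f p = s.1 * ell_lo L i p + s.2 * m i p].
Definition vder2 L m f : E -> R := fun p => (vder L m f p).2.
Definition hder1 L m f : E -> R := fun p => (hder L m f p).1.
Definition hder2 L m f : E -> R := fun p => (hder L m f p).2.

Definition T_lo L m i j k h : E -> R := fun p =>
  vder2 L m (main_scalar L m) p * m i p * m j p * m k p * m h p / L p.
Definition T_up L m i j k h : E -> R := fun p =>
  \sum_(n < 2) g_up L i n p * T_lo L m n j k h p.

Definition sigma L m (eps : R) f : E -> R := fun p =>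
  vder2 L m (vder2 L m f) p + eps * main_scalar L m p * vder2 L m f p
  + 2 * vder2 L m f p ^+ 2.
Definition rho L m (eps : R) f : E -> R := fun p =>
  (sigma L m eps f p + eps - vder2 L m f p ^+ 2)^-1.

(* m^i d_i f  and  ell^i d_i f *)
Definition m_dx L m f : E -> R := fun p => \sum_i m_up L m i p * dx i f p.
Definition ell_dx L f : E -> R := fun p => \sum_i ell_up L i p * dx i f p.

End LocalCalculus.

Section FinslerSurface.
Variables (R : realType) (M : smooth_surface R).
Local Notation E := ('rV[R]_2 * 'rV[R]_2)%type.
Implicit Types (A : set (tvec M)) (F phi : tvec M -> R) (eps : R)
  (m : chart_idx M -> 'I_2 -> E -> R).

Record conic_pseudo_finsler A F : Prop := ConicPseudoFinsler {
  finsler_conic : conic_subbundle A;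
  finsler_smooth : smooth_fun A F;
  finsler_homogeneous : homogeneous_fun A 1 F;
  finsler_nondegenerate : forall a p, local_dom A a p ->
    g_mx (local_fun F a) p \in unitmx
}.

(* The frame covector is only determined up to sign, hence is given chart by
   chart; nothing below depends on the signs. *)
Record berwald_frame A F eps m : Prop := BerwaldFrame {
  frame_sign : eps = 1 \/ eps = -1;
  frame_smooth : forall a i, smooth_on (local_dom A a) (m a i);
  frame_metric : forall a p i j, local_dom A a p ->
    g_lo (local_fun F a) i j p =
      ell_lo (local_fun F a) i p * ell_lo (local_fun F a) j p
      + eps * m a i p * m a j p
}.

Record anisotropic_conformal A F eps m phi : Prop := AnisotropicConformal {
  aniso_smooth : smooth_fun A phi;
  aniso_homogeneous : homogeneous_fun A 0 phi;
  aniso_neq0 : forall a p, local_dom A a p ->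
    eps + sigma (local_fun F a) (m a) eps (local_fun phi a) p
    - vder2 (local_fun F a) (m a) (local_fun phi a) p ^+ 2 != 0
}.

Definition aniso_metric F phi : tvec M -> R := fun v => expR (phi v) * F v.

Definition aniso_frame F eps m phi : chart_idx M -> 'I_2 -> E -> R :=
  fun a i p => expR (local_fun phi a p)
    * Num.sqrt (eps / rho (local_fun F a) (m a) eps (local_fun phi a) p)
    * m a i p.

(* The transformed metric admits a frame with the same sign [eps]: the square
   root in [aniso_frame] is that of a positive number. *)
Definition same_frame_sign A F eps m phi : Prop :=
  forall a p, local_dom A a p ->
    0 < eps / rho (local_fun F a) (m a) eps (local_fun phi a) p.

Definition riemannian A F m : Prop := forall a p, local_dom A a p ->
  main_scalar (local_fun F a) (m a) p = 0.

Definition landsberg A F m : Prop := forall a p, local_dom A a p ->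
  hder1 (local_fun F a) (m a) (main_scalar (local_fun F a) (m a)) p = 0.

Definition berwaldian A F m : Prop := forall a p, local_dom A a p ->
  hder1 (local_fun F a) (m a) (main_scalar (local_fun F a) (m a)) p = 0 /\
  hder2 (local_fun F a) (m a) (main_scalar (local_fun F a) (m a)) p = 0.

(* (d_i phi) T^i_jkr = 0, with T the T-tensor of [F].  As d_i phi is not
   tensorial when phi depends on y, this is required in every chart of the
   atlas under consideration. *)
Definition phiT_condition A F m phi : Prop :=
  forall a p j k r, local_dom A a p ->
    \sum_i dx i (local_fun phi a) p
      * T_up (local_fun F a) (m a) i j k r p = 0.

Definition C_anisotropic_at F phi (a : chart_idx M) (p : E) : Prop :=
  forall j k,
    \sum_i C_up (local_fun F a) i j k p * dx i (local_fun phi a) p = 0.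

End FinslerSurface.

(* Main.v *)
Require Import Defs.
From HB Require Import structures.
From mathcomp Require Import all_boot all_order all_algebra ring lra.
From mathcomp Require Import all_classical all_reals all_analysis.
Import Order.TTheory GRing.Theory Num.Theory.
Import numFieldNormedType.Exports.
Local Open Scope classical_set_scope.
Local Open Scope ring_scope.

(** Everything is local, so the work takes place in one chart, on an open set
    of points (x, y) that is stable under positive scaling of y.

    Part (i).  Write I for the main scalar.  The condition on the T-tensor says
    that I_;2 m^i (d_i phi) = 0, so I_;2 = 0 because m^i d_i phi does not
    vanish; and I_;1 = 0 because I is homogeneous of degree 0 in y.  Hence I
    does not depend on y, at least locally, and its horizontal derivatives are
    the plain derivatives d_i I.  The Landsberg condition now reads
    y^i d_i I = 0.  The coefficients d_i I are locally constant in y, while y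
    ranges over an open set, so they vanish, and with them I_,2
    ([landsberg_hder2]).  No second derivative of I is needed.

    Part (ii).  This is part (i) for the metric Fbar, once mbar is known to be
    a frame for it.  The Euler relations and the frame derivatives
      F dy_k ell_i = eps m_i m_k   and   F dy_k m_i = (eps I m_i - ell_i) m_k
    ([dy_ell], [dy_m]) turn the Hessian of Fbar^2 / 2 into
      gbar_ij = ellbar_i ellbar_j + e^(2 phi) rho^-1 m_i m_j
    ([g_conformal]), whose last term is eps mbar_i mbar_j
    ([frame_conformal_metric]).  The contravariant vector mbar^i is a positive
    multiple of m^i - eps phi_;2 ell^i ([m_dx_conformal]), which turns the
    hypothesis of (ii) into the hypothesis of (i).  The second form of (ii)
    uses instead that Cbar^i_jk d_i phi = Ibar mbar_j mbar_k (mbar^i d_i phi)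
    / Fbar ([C_upE]), so that mbar^i d_i phi cannot vanish at any point. *)

Set Implicit Arguments.
Unset Strict Implicit.
Unset Printing Implicit Defensive.

(** * Smooth functions on open sets *)

Lemma near_eq_differentiable (R : numFieldType) (V W : normedModType R)
    (f g : V -> W) (x : V) :
  {near x, f =1 g} -> differentiable f x -> differentiable g x.
Proof.
move=> fg Df; apply/diffP.
apply: (@getPex _ (fun (df : {linear V -> W}) => continuous df /\
  forall y, g y = g (lim (nbhs x)) + df (y - lim (nbhs x))
                  +o_(y \near x) (y - lim (nbhs x)))).
exists ('d f x); split; first exact: diff_continuous.
suff E : g = (fun y => g (lim (nbhs x)) + 'd f x (y - lim (nbhs x)))
    +o_x (fun y => y - lim (nbhs x)).
  by move=> y; rewrite {1}E.
apply/eqaddoP => e e0.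
have [_ /funext/eqaddoE/eqaddoP/(_ e e0)] := (diffP _ _).1 Df.
rewrite lim_id //; apply: filter_app.
near=> y; rewrite /= !fctE.
have -> : f y = g y by near: y.
by have -> : f x = g x by exact: (nbhs_singleton fg).
Unshelve. all: by end_near. Qed.

(** Two maps, possibly on different spaces, with the same restriction to the
    lines considered have the same directional derivative. *)
Lemma derive_change (R : numFieldType) (V V' W : normedModType R)
    (f : V -> W) (g : V' -> W) (x v : V) (y w : V') :
  (forall h : R, f (h *: v + x) = g (h *: w + y)) ->
  'D_v f x = 'D_w g y /\ (derivable g y w -> derivable f x v).
Proof.
move=> fg; rewrite /derive /derivable.
suff -> : (fun h : R => h^-1 *: ((f \o shift x) (h *: v) - f x)) =
    (fun h : R => h^-1 *: ((g \o shift y) (h *: w) - g y)) by [].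
by apply/funext => h /=; rewrite fg; have := fg 0; rewrite !scale0r !add0r => ->.
Qed.

Section SmoothFunctions.
Variables (R : realType) (V : normedModType R) (U : set V).
Hypothesis oU : open U.
Implicit Types (f g : V -> R) (v x : V) (n : nat).

Lemma near_open x : U x -> \forall y \near x, U y.
Proof. by move=> Ux; apply: open_nbhs_nbhs; split. Qed.

Lemma Cn_on_eq n f g :
  (forall x, U x -> f x = g x) -> Cn_on n U f -> Cn_on n U g.
Proof.
elim: n f g => [|n IH] f g fg /=.
  move=> cf x Ux; have {}Ux : U x by rewrite inE in Ux.
  have nfg : \forall y \near x, f y = g y.
    by apply: filterS (near_open Ux) => y; exact: fg.
  rewrite /continuous_at -fg //; apply: cvg_trans (cf x (mem_set Ux)).
  exact: near_eq_cvg.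
case=> Df Cf; split=> [x Ux|v].
  apply: (@near_eq_differentiable _ _ _ f); last exact: Df.
  by apply: filterS (near_open Ux) => y; exact: fg.
apply: IH (Cf v) => x Ux; apply: near_eq_derive.
by apply: filterS (near_open Ux) => y; exact: fg.
Qed.

Lemma Cn_onW n f : Cn_on n.+1 U f -> Cn_on n U f.
Proof.
elim: n f => [|n IH] f [Df Cf].
  by move=> x; rewrite inE => Ux; apply: differentiable_continuous; exact: Df.
by split=> // v; apply: IH; exact: Cf.
Qed.

Lemma Cn_on_cst n (c : R) : Cn_on n U (fun=> c).
Proof.
elim: n c => [|n IH] c /=; first by move=> x _; exact: cvg_cst.
split=> [x _|v]; first exact: differentiable_cst.
by apply: (@Cn_on_eq _ (fun=> 0)) (IH 0) => x _; rewrite derive_cst.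
Qed.

Lemma Cn_onD n f g :
  Cn_on n U f -> Cn_on n U g -> Cn_on n U (fun x => f x + g x).
Proof.
elim: n f g => [|n IH] f g /=.
  by move=> cf cg x Ux; apply: cvgD; [exact: cf|exact: cg].
move=> [Df Cf] [Dg Cg]; split=> [x Ux|v].
  by apply: differentiableD; [exact: Df|exact: Dg].
apply: (@Cn_on_eq _ (fun x => 'D_v f x + 'D_v g x)); last by apply: IH.
move=> x Ux; rewrite [RHS]deriveD //.
- by apply: diff_derivable; exact: Df.
- by apply: diff_derivable; exact: Dg.
Qed.

Lemma derive_mul f g v x : differentiable f x -> differentiable g x ->
  'D_v (fun y => f y * g y) x = f x * 'D_v g x + g x * 'D_v f x.
Proof. by move=> Df Dg; apply: deriveM; exact: diff_derivable. Qed.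

Lemma Cn_onM n f g :
  Cn_on n U f -> Cn_on n U g -> Cn_on n U (fun x => f x * g x).
Proof.
elim: n f g => [|n IH] f g.
  by move=> cf cg x Ux; apply: cvgM; [exact: cf|exact: cg].
move=> Cf Cg; have [Df DCf] := Cf; have [Dg DCg] := Cg.
split=> [x Ux|v].
  by apply: differentiableM; [exact: Df|exact: Dg].
apply: (@Cn_on_eq _ (fun x => f x * 'D_v g x + g x * 'D_v f x)).
  by move=> x Ux; rewrite derive_mul //; [exact: Df|exact: Dg].
apply: Cn_onD; apply: IH; [exact: Cn_onW|exact: DCg|exact: Cn_onW|exact: DCf].
Qed.

Lemma derive_expRf f v x : differentiable f x ->
  'D_v (fun y => expR (f y)) x = expR (f x) * 'D_v f x.
Proof.
move=> Df; have De : differentiable (expR : R -> R) (f x).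
  by apply/derivable1_diffP; exact: derivable_expR.
rewrite deriveE; last exact: differentiable_comp.
rewrite (diff_comp Df De) /= -[X in 'd expR _ X]mulr1.
rewrite -['d f x v * 1]/('d f x v *: (1 : R)) linearZ /=.
have -> : 'd expR (f x) 1 = expR (f x) by rewrite -deriveE // derive_val.
by rewrite deriveE // mulrC.
Qed.

Lemma smooth_on_expR f : smooth_on U f -> smooth_on U (fun x => expR (f x)).
Proof.
move=> Cf n; elim: n => [|n IH].
  move=> x Ux; have := Cf 0%N x Ux.
  by move=> cf; apply: (continuous_comp cf); exact: continuous_expR.
have [Df DCf] := Cf n.+1; split=> [x Ux|v].
  apply: (@differentiable_comp _ _ _ _ f expR); first exact: Df.
  by apply/derivable1_diffP; exact: derivable_expR.
apply: (@Cn_on_eq _ (fun x => expR (f x) * 'D_v f x)).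
  by move=> x Ux; rewrite derive_expRf //; exact: Df.
by apply: Cn_onM; [exact: IH|exact: DCf].
Qed.

Lemma smooth_on_cst (c : R) : smooth_on U (fun=> c).
Proof. by move=> n; exact: Cn_on_cst. Qed.

Lemma smooth_onM f g :
  smooth_on U f -> smooth_on U g -> smooth_on U (fun x => f x * g x).
Proof. by move=> Cf Cg n; exact: Cn_onM. Qed.

Lemma smooth_on_derive f v : smooth_on U f -> smooth_on U ('D_v f).
Proof. by move=> Cf n; have [_ D] := Cf n.+1; exact: D. Qed.

Lemma smooth_on_differentiable f x : smooth_on U f -> U x -> differentiable f x.
Proof. by move=> Cf; have [Df _] := Cf 1%N; exact: Df. Qed.

End SmoothFunctions.

Section Coordinates.
Variable R : realType.
Local Notation E := ('rV[R]_2 * 'rV[R]_2)%type.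
Implicit Types (U : set E) (f : E -> R) (p q : E) (i j k : 'I_2).

(** The homothety (x, y) |-> (x, l y) of the fibres. *)
Definition stretch (l : R) p : E := (p.1, l *: p.2).

(** [f] is positively homogeneous of degree [r] in y on [U]; the degree is real
    because the Cartan tensor has degree -1. *)
Definition fiber_homogeneous U (r : R) f :=
  forall p (l : R), U p -> 0 < l -> f (stretch l p) = l `^ r * f p.

Lemma derive_fiber f p (v : 'rV[R]_2) : differentiable f p ->
  'D_((0, v) : E) f p = \sum_i v 0 i * dy i f p.
Proof.
move=> Df; rewrite /dy deriveE //.
under eq_bigr do rewrite deriveE //.
have -> : ((0, v) : E) = \sum_i v 0 i *: ((0, delta_mx 0 i) : E).
  rewrite big_ord_recl big_ord1 [v in LHS]row_sum_delta.
  rewrite big_ord_recl big_ord1.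
  by congr pair; rewrite /= !scaler0 addr0.
by rewrite linear_sum /=; under eq_bigr do rewrite linearZ /=.
Qed.

Lemma derive_stretch f p (l : R) v :
  'D_v (fun q => f (stretch l q)) p = 'D_(stretch l v) f (stretch l p).
Proof.
apply: (derive_change _).1 => h; congr (f _); congr pair => /=.
by rewrite scalerDr !scalerA mulrC.
Qed.

Lemma dy_homogeneous U (r : R) f i : open U ->
  (forall p (l : R), U p -> 0 < l -> U (stretch l p)) ->
  (forall p, U p -> differentiable f p) ->
  fiber_homogeneous U r f -> fiber_homogeneous U (r - 1) (dy i f).
Proof.
move=> oU cU Df hf p l Up l0.
have l1 : l != 0 by rewrite gt_eqF.
have : 'D_((0, delta_mx 0 i) : E) (fun q => f (stretch l q)) p
     = 'D_((0, delta_mx 0 i) : E) (fun q => l `^ r * f q) p.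
  by apply: near_eq_derive; apply: filterS (near_open oU Up) => q Uq; exact: hf.
rewrite derive_stretch derive_mul; last 2 first.
- exact: differentiable_cst.
- exact: Df.
rewrite derive_cst mulr0 addr0 => E1.
have : 'D_(l *: ((0, delta_mx 0 i) : E)) f (stretch l p)
     = l `^ r * 'D_((0, delta_mx 0 i) : E) f p.
  rewrite -E1; congr ('D_ _ _ _); congr pair => /=.
  by rewrite scaler0.
rewrite deriveE; last by apply: Df; exact: cU.
rewrite linearZ /= -deriveE; last by apply: Df; exact: cU.
move=> E2; rewrite powRB; last by rewrite l1 implybT.
rewrite powRr1 ?ltW // mulrAC -E2 /dy.
by rewrite -[_ *: _]/(l * _) mulrAC divff // mul1r.
Qed.

(** Euler's relation.  The left side is y^i dy_i f, see [derive_fiber]; written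
    as a directional derivative it needs no differentiability of [f]. *)
Lemma euler U (r : R) f p : open U ->
  fiber_homogeneous U r f -> U p -> 'D_((0, p.2) : E) f p = r * f p.
Proof.
move=> oU hf Up.
have -> : 'D_((0, p.2) : E) f p = 'D_1 (fun t : R => f (stretch t p)) 1.
  apply: (derive_change _).1 => h; congr (f _); congr pair => /=.
    by rewrite scaler0 add0r.
  by rewrite scalerDl scale1r [h *: 1]mulr1.
have -> : 'D_1 (fun t : R => f (stretch t p)) 1 = 'D_1 (fun t : R => t `^ r * f p) 1.
  apply: near_eq_derive; near=> t; apply: hf => //.
  by near: t; exact: lt_nbhsr.
have D1 := @is_derive1_powR R r 1 ltr01.
rewrite derive_mul; last 2 first.
- by apply/derivable1_diffP; apply: ex_derive.
- exact: differentiable_cst.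
by rewrite derive_cst mulr0 add0r derive_val powR1 mulr1 mulrC.
Unshelve. all: by end_near. Qed.

Lemma fiber_segment_cst f (x y y' : 'rV[R]_2) :
  (forall t : R, 0 <= t <= 1 ->
     differentiable f (x, y + t *: (y' - y)) /\
     forall j, dy j f (x, y + t *: (y' - y)) = 0) ->
  f (x, y') = f (x, y).
Proof.
move=> H; pose g (t : R) := f (x, y + t *: (y' - y)).
have D (t : R) : 0 <= t <= 1 -> is_derive t (1 : R) g 0.
  move=> /H[Df D0].
  have Dv : 'D_((0, y' - y) : E) f (x, y + t *: (y' - y)) = 0.
    by rewrite derive_fiber // big1 // => j _; rewrite D0 mulr0.
  have [Dg Eg] : 'D_1 g t = 'D_((0, y' - y) : E) f (x, y + t *: (y' - y)) /\
      (derivable f (x, y + t *: (y' - y)) ((0, y' - y) : E) -> derivable g t 1).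
    apply: derive_change => h; congr (f _); congr pair => /=.
      by rewrite scaler0 add0r.
    by rewrite scalerDl addrCA [h *: 1]mulr1.
  by apply: DeriveDef; [apply: Eg; exact: diff_derivable|rewrite Dg].
have D01 (t : R) : t \in `]0, 1[ -> is_derive t (1 : R) g 0.
  by move=> tI; apply: D; rewrite !(itvP tI).
have cg : {within `[0, 1], continuous g}.
  apply: derivable_within_continuous => t tI; apply: ex_derive; apply: D.
  by rewrite !(itvP tI).
have [c _] := MVT ltr01 D01 cg.
rewrite mul0r /g scale1r scale0r addr0 [y + _]addrC subrK => /eqP.
by rewrite subr_eq0 => /eqP.
Qed.

(** If all the dy_j f vanish on an open set, then dx_i f is locally constant
    along the fibres. *)
Lemma dx_locally_cst U f p i : open U -> (forall q, U q -> differentiable f q) ->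
  (forall q j, U q -> dy j f q = 0) -> U p ->
  \forall y \near p.2, dx i f (p.1, y) = dx i f p.
Proof.
move=> oU Df D0 Up.
have /nbhs_ballP[e /= e0 He] := near_open oU Up.
(* Product balls are convex along the fibres, so [f] does not depend on y
   there. *)
have cst x y : ball p.1 e x -> ball p.2 e y -> f (x, y) = f (x, p.2).
  move=> bx bz; apply: fiber_segment_cst => t /andP[t0 t1].
  have Ut : U (x, p.2 + t *: (y - p.2)).
    apply: He; split => //=; rewrite -ball_normE /= opprD addNKr normrN normrZ.
    move: bz; rewrite -ball_normE /= distrC => bz.
    by apply: le_lt_trans bz; rewrite ler_piMl // ger0_norm.
  by split; [exact: Df|move=> j; exact: D0].
have dxE y : dx i f (p.1, y) = 'D_(delta_mx 0 i) (fun x => f (x, y)) p.1.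
  apply: (derive_change _).1 => h; congr (f _); congr pair => /=.
  by rewrite scaler0 add0r.
near=> y; rewrite dxE.
rewrite [in RHS](surjective_pairing p) dxE; apply: near_eq_derive.
near=> x; apply: cst.
- by near: x; exact: nbhsx_ballx.
- by near: y; exact: nbhsx_ballx.
Unshelve. all: by end_near. Qed.

End Coordinates.

(** * Algebra over two indices *)

Lemma ord2P (i : 'I_2) : i = 0 \/ i = 1.
Proof. by case: i => [[|[|//]] ?]; [left|right]; apply/val_inj. Qed.

Lemma sum_ord2 (R : realType) (f : 'I_2 -> R) : \sum_i f i = f 0 + f 1.
Proof.
by rewrite big_ord_recl big_ord1; congr (_ + f _); apply/val_inj.
Qed.

Lemma ord2_delta (R : realType) (f : 'I_2 -> R) k :
  f k = f 0 * (k == 0)%:R + f 1 * (k == 1)%:R.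
Proof.
by case: (ord2P k) => ->; rewrite eqxx mulr1 mulr0 ?addr0 ?add0r.
Qed.

Lemma det_mx2 (R : realType) (B : 'M[R]_2) :
  \det B = B 0 0 * B 1 1 - B 0 1 * B 1 0.
Proof.
rewrite (expand_det_row _ 0) sum_ord2 /cofactor !det_mx11 !mxE /= expr0 expr1.
have -> : lift (0 : 'I_2) 0 = 1 by apply/val_inj.
have -> : lift (1 : 'I_2) 0 = 0 by apply/val_inj.
by rewrite mul1r mulN1r mulrN.
Qed.

(** A three-index array which is proportional to [v] in each index is a multiple
    of v_i v_j v_k. *)
Lemma trilinear_rank1 (K : fieldType) (I : Type) (c : I -> I -> I -> K)
    (v : I -> K) (l : I) : v l != 0 ->
  (forall a b d, c a b d = c b a d) ->
  (forall a b d e, c a b d * v e = c e b d * v a) ->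
  (forall a b d e, c a b d * v e = c a b e * v d) ->
  forall i j k, c i j k = c l l l / v l ^+ 3 * v i * v j * v k.
Proof.
move=> vl cC c1 c3 i j k; apply: (mulIf (expf_neq0 3 vl)).
transitivity (c i j k * v l * v l * v l); first by ring.
rewrite c1 cC.
transitivity (c j l k * v l * v i * v l); first by ring.
rewrite c1.
transitivity (c l l k * v l * v j * v i); first by ring.
by rewrite c3; field.
Qed.

(** The linear system satisfied by the derivatives d_i of the frame covector
    v_i determines them: the array v_a X_b + v_b X_a vanishes only for X = 0. *)
Lemma frame_derivative (K : numFieldType) (I : Type) (v l d : I -> K)
    (s e w : K) : e * e = 1 -> (exists k, v k != 0) ->
  (forall a b, s * v a * v b * w = 2^-1 * (l a * (e * w * v b)
     + l b * (e * w * v a) + e * (v a * d b + v b * d a))) ->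
  forall i, d i = (e * s * v i - l i) * w.
Proof.
move=> e2 [k vk] H i; pose X j := d j - (e * s * v j - l j) * w.
have {}H a b : v a * X b + v b * X a = 0.
  transitivity (e * e * (v a * d b + v b * d a + l b * w * v a + l a * w * v b)
    - 2 * e * (s * v a * v b * w)); first by rewrite e2 /X; ring.
  by rewrite H; field.
suff : X i = 0 by move/eqP; rewrite subr_eq0 => /eqP.
have Xk : X k = 0.
  apply: (mulfI vk); rewrite mulr0; have := H k k; rewrite -mulr2n => /eqP.
  by rewrite mulrn_eq0 => /eqP.
by apply: (mulfI vk); rewrite mulr0 -[RHS](H i k) Xk mulr0 add0r.
Qed.

(** * Differentiation rules in induced coordinates *)

Section DifferentiationRules.
Variable R : realType.
Local Notation E := ('rV[R]_2 * 'rV[R]_2)%type.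
Implicit Types (f g : E -> R) (p v : E).

Lemma derive_add f g v p : differentiable f p -> differentiable g p ->
  'D_v (fun q => f q + g q) p = 'D_v f p + 'D_v g p.
Proof. by move=> Df Dg; apply: deriveD; exact: diff_derivable. Qed.

Lemma derive_scale (c : R) f v p : differentiable f p ->
  'D_v (fun q => c * f q) p = c * 'D_v f p.
Proof.
by move=> Df; rewrite derive_mul // ?derive_cst ?mulr0 ?addr0 //;
  exact: differentiable_cst.
Qed.

Lemma differentiable_scale (c : R) f p : differentiable f p ->
  differentiable (fun q => c * f q) p.
Proof. by move=> Df; apply: differentiableM => //; exact: differentiable_cst. Qed.

End DifferentiationRules.

Lemma dyE (R : realType) i (f : 'rV[R]_2 * 'rV[R]_2 -> R) p :
  dy i f p = 'D_((0, delta_mx 0 i) : 'rV[R]_2 * 'rV[R]_2) f p.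
Proof. by []. Qed.

Section Unfold.
Variable R : realType.
Local Notation E := ('rV[R]_2 * 'rV[R]_2)%type.
Variables (L : E -> R) (m : 'I_2 -> E -> R).
Implicit Types (i j k : 'I_2) (p : E).

(** The determinant of the coframe (ell, m). *)
Definition wedge p := ell_lo L 0 p * m 1 p - ell_lo L 1 p * m 0 p.

Lemma g_loE i j : g_lo L i j = fun p => 2^-1 * dy i (dy j (sqrF L)) p.
Proof. by []. Qed.
Lemma C_loE i j k : C_lo L i j k = fun p => 2^-1 * dy k (g_lo L i j) p.
Proof. by []. Qed.
Lemma ell_loE i : ell_lo L i = dy i L.
Proof. by []. Qed.
Lemma sqrFE : sqrF L = fun p => L p * L p.
Proof. by []. Qed.
Lemma wedgeE p : wedge p = ell_lo L 0 p * m 1 p - ell_lo L 1 p * m 0 p.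
Proof. by []. Qed.
Lemma ycE i p : yc i p = p.2 0 i.
Proof. by []. Qed.
Lemma main_scalarE p : main_scalar L m p = get [set s : R | forall i j k,
    L p * C_lo L i j k p = s * m i p * m j p * m k p].
Proof. by []. Qed.
Lemma vderE f p : vder L m f p = get [set s : R * R | forall i,
    L p * dy i f p = s.1 * ell_lo L i p + s.2 * m i p].
Proof. by []. Qed.
Lemma hderE f p : hder L m f p = get [set s : R * R | forall i,
    delta L i f p = s.1 * ell_lo L i p + s.2 * m i p].
Proof. by []. Qed.
End Unfold.

Section DyRules.
Variable R : realType.
Local Notation E := ('rV[R]_2 * 'rV[R]_2)%type.
Implicit Types (f g : E -> R) (p : E) (k : 'I_2).

Lemma dyD k f g p : differentiable f p -> differentiable g p ->
  dy k (fun q => f q + g q) p = dy k f p + dy k g p.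
Proof. exact: derive_add. Qed.

Lemma dyZ k (c : R) f p : differentiable f p ->
  dy k (fun q => c * f q) p = c * dy k f p.
Proof. exact: derive_scale. Qed.

Lemma dyM k f g p : differentiable f p -> differentiable g p ->
  dy k (fun q => f q * g q) p = f p * dy k g p + g p * dy k f p.
Proof. exact: derive_mul. Qed.

Lemma smooth_on_dy (U : set E) k f : smooth_on U f -> smooth_on U (dy k f).
Proof. exact: smooth_on_derive. Qed.

End DyRules.

(* Two distinct derivatives must not be compared by unfolding them to limits;
   the equations above give access to the definitions. *)
Local Opaque derive dx dy xget invmx g_lo C_lo ell_lo sqrF wedge yc.
Local Opaque main_scalar vder hder.

(** * Berwald frames in a chart *)

Section FrameChart.
Variable R : realType.
Local Notation E := ('rV[R]_2 * 'rV[R]_2)%type.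
Implicit Types (U : set E) (L : E -> R) (m : 'I_2 -> E -> R) (p : E).
Implicit Types (i j k : 'I_2).

Lemma det_frame L (eps : R) m p :
  (forall i j, g_lo L i j p =
     ell_lo L i p * ell_lo L j p + eps * m i p * m j p) ->
  \det (g_mx L p) = eps * wedge L m p ^+ 2.
Proof.
move=> gE; rewrite det_mx2 !mxE wedgeE (gE 0 0) (gE 1 1) (gE 0 1) (gE 1 0).
generalize (ell_lo L 0 p) (ell_lo L 1 p) (m 0 p) (m 1 p) => l0 l1 m0 m1.
by ring.
Qed.

(** The expression in a chart of a conic pseudo-Finsler metric [L] with a
    modified Berwald frame [m], over a domain [U].  Of the covector [m] only
    differentiability is required, which is easier to establish for the frame of
    a conformally changed metric. *)
Record frame_chart U L (eps : R) m : Prop := FrameChart {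
  fc_open : open U;
  fc_cone : forall p (l : R), U p -> 0 < l -> U (stretch l p);
  fc_neq0 : forall p, U p -> p.2 != 0;
  fc_smooth : smooth_on U L;
  fc_homogeneous : fiber_homogeneous U 1 L;
  fc_unit : forall p, U p -> g_mx L p \in unitmx;
  fc_sign : eps = 1 \/ eps = -1;
  fc_diff : forall p i, U p -> differentiable (m i) p;
  fc_metric : forall p i j, U p ->
    g_lo L i j p = ell_lo L i p * ell_lo L j p + eps * m i p * m j p
}.

Section Theory.
Variables (U : set E) (L : E -> R) (eps : R) (m : 'I_2 -> E -> R).
Hypothesis fc : frame_chart U L eps m.
Let oU := fc_open fc.

Lemma frame_sign_sqr : eps * eps = 1.
Proof. by case: (fc_sign fc) => ->; ring. Qed.

Lemma eps_neq0 : eps != 0.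
Proof. by case: (fc_sign fc) => ->; rewrite ?oppr_eq0 oner_neq0. Qed.

Lemma metric_diff p : U p -> differentiable L p.
Proof. exact: smooth_on_differentiable (fc_smooth fc). Qed.

Lemma sqrF_smooth : smooth_on U (sqrF L).
Proof. exact: smooth_onM (fc_smooth fc) (fc_smooth fc). Qed.

Lemma ell_smooth i : smooth_on U (ell_lo L i).
Proof. exact: smooth_on_dy (fc_smooth fc). Qed.

Lemma g_lo_smooth i j : smooth_on U (g_lo L i j).
Proof.
apply: smooth_onM => //; first exact: smooth_on_cst.
by apply: smooth_on_dy; apply: smooth_on_dy; exact: sqrF_smooth.
Qed.

Lemma C_lo_smooth i j k : smooth_on U (C_lo L i j k).
Proof.
apply: smooth_onM => //; first exact: smooth_on_cst.
by apply: smooth_on_dy; exact: g_lo_smooth.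
Qed.

Lemma dy_sqrF i p : U p -> dy i (sqrF L) p = 2 * (L p * ell_lo L i p).
Proof.
move=> Up; rewrite dyE (derive_mul _ (metric_diff Up) (metric_diff Up)).
by rewrite ell_loE dyE; ring.
Qed.

Lemma dy_sqrF_homogeneous i : fiber_homogeneous U 1 (dy i (sqrF L)).
Proof.
have -> : (1 : R) = 2 - 1 by ring.
apply: dy_homogeneous => //; first exact: fc_cone fc.
  by move=> p; apply: smooth_on_differentiable; exact: sqrF_smooth.
move=> p l Up l0; rewrite sqrFE (fc_homogeneous fc) //.
by rewrite powRr1 ?ltW // powR_mulrn ?ltW // expr2 mulrACA.
Qed.

Lemma g_lo_homogeneous i j : fiber_homogeneous U 0 (g_lo L i j).
Proof.
move=> p l Up l0; rewrite g_loE.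
have D q : U q -> differentiable (dy j (sqrF L)) q.
  apply: smooth_on_differentiable.
  by apply: smooth_on_dy; exact: sqrF_smooth.
have /(_ p l Up l0) := dy_homogeneous i oU (fc_cone fc) D (dy_sqrF_homogeneous j).
by rewrite subrr powRr0 !mul1r => ->.
Qed.

Lemma C_lo_homogeneous i j k : fiber_homogeneous U (-1) (C_lo L i j k).
Proof.
move=> p l Up l0; rewrite C_loE.
have D q : U q -> differentiable (g_lo L i j) q.
  by apply: smooth_on_differentiable; exact: g_lo_smooth.
have /(_ p l Up l0) := dy_homogeneous k oU (fc_cone fc) D (g_lo_homogeneous i j).
by rewrite sub0r => ->; rewrite mulrCA.
Qed.

Lemma ell_yc p : U p -> \sum_i yc i p * ell_lo L i p = L p.
Proof.
move=> Up; rewrite -[RHS]mul1r -(euler oU (fc_homogeneous fc) Up) derive_fiber //.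
exact: metric_diff.
Qed.

Lemma g_lo_yc j p : U p -> \sum_i yc i p * g_lo L i j p = L p * ell_lo L j p.
Proof.
move=> Up; have D : differentiable (dy j (sqrF L)) p.
  apply: smooth_on_differentiable Up.
  by apply: smooth_on_dy; exact: sqrF_smooth.
have := euler oU (dy_sqrF_homogeneous j) Up.
rewrite derive_fiber // mul1r dy_sqrF // => E1.
rewrite -[RHS]mul1r -(@mulVf R 2) ?pnatr_eq0 // -mulrA -E1 mulr_sumr.
by apply: eq_bigr => i _; rewrite g_loE mulrCA.
Qed.

(** From F^2 = g_ij y^i y^j = F^2 + eps (m_i y^i)^2. *)
Lemma m_yc p : U p -> \sum_i yc i p * m i p = 0.
Proof.
move=> Up; have Ey := ell_yc Up; rewrite sum_ord2 in Ey.
have E0 := g_lo_yc 0 Up; rewrite sum_ord2 in E0.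
have E1 := g_lo_yc 1 Up; rewrite sum_ord2 in E1.
rewrite (fc_metric fc 0 0 Up) (fc_metric fc 1 0 Up) in E0.
rewrite (fc_metric fc 0 1 Up) (fc_metric fc 1 1 Up) in E1.
rewrite sum_ord2; move: Ey E0 E1.
move: (yc 0 p) (yc 1 p) (ell_lo L 0 p) (ell_lo L 1 p) (m 0 p) (m 1 p) (L p).
move=> y0 y1 l0 l1 m0 m1 F Ey E0 E1.
have : eps * (y0 * m0 + y1 * m1) ^+ 2 = 0.
  have H := congr2 (fun a b => y0 * a + y1 * b) E0 E1.
  apply/eqP; rewrite -[X in _ == X](subrr (F * F)) -{1}Ey; apply/eqP.
  transitivity (y0 * (y0 * (l0 * l0 + eps * m0 * m0) + y1 * (l1 * l0 + eps * m1 * m0))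
     + y1 * (y0 * (l0 * l1 + eps * m0 * m1) + y1 * (l1 * l1 + eps * m1 * m1))
     - (y0 * l0 + y1 * l1) ^+ 2); first by ring.
  by rewrite E0 E1 -Ey; ring.
by move/eqP; rewrite mulf_eq0 (negPf eps_neq0) /= sqrf_eq0 => /eqP.
Qed.

Lemma det_g p : U p -> \det (g_mx L p) = eps * wedge L m p ^+ 2.
Proof. by move=> Up; apply: det_frame => i j; exact: (fc_metric fc). Qed.

Lemma wedge_neq0 p : U p -> wedge L m p != 0.
Proof.
move=> Up; have := fc_unit fc Up; rewrite unitmxE unitfE det_g //.
by rewrite mulf_eq0 sqrf_eq0 negb_or => /andP[].
Qed.

(** At a zero of F both covectors of the frame would kill y, which is non-zero. *)
Lemma metric_neq0 p : U p -> L p != 0.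
Proof.
move=> Up; apply/eqP => L0.
have := m_yc Up; have := ell_yc Up; have := fc_neq0 fc Up.
move=> /eqP y0 Ey Em; apply: y0.
rewrite sum_ord2 L0 in Ey; rewrite sum_ord2 in Em.
suff [Y0 Y1] : yc 0 p = 0 /\ yc 1 p = 0.
  by apply/rowP => i; rewrite mxE; case: (ord2P i) => ->.
move: (wedge_neq0 Up) Ey Em; rewrite wedgeE.
move: (yc 0 p) (yc 1 p) (ell_lo L 0 p) (ell_lo L 1 p) (m 0 p) (m 1 p).
move=> y0 y1 l0 l1 m0 m1 w0 Ey Em.
split; apply: (mulIf w0); rewrite mul0r.
  transitivity (m1 * (y0 * l0 + y1 * l1) - l1 * (y0 * m0 + y1 * m1)); first by ring.
  by rewrite Ey Em !mulr0 subrr.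
transitivity (l0 * (y0 * m0 + y1 * m1) - m0 * (y0 * l0 + y1 * l1)); first by ring.
by rewrite Ey Em !mulr0 subrr.
Qed.

(** The components of y expressed by those of m. *)
Lemma yc_wedge p : U p ->
  yc 0 p * wedge L m p = L p * m 1 p /\ yc 1 p * wedge L m p = - L p * m 0 p.
Proof.
move=> Up; have Em := m_yc Up; have Ey := ell_yc Up; rewrite sum_ord2 in Ey.
rewrite sum_ord2 in Em; move: Ey Em; rewrite wedgeE.
move: (yc 0 p) (yc 1 p) (ell_lo L 0 p) (ell_lo L 1 p) (m 0 p) (m 1 p) (L p).
move=> y0 y1 l0 l1 m0 m1 F <- Em; split.
  transitivity ((y0 * l0 + y1 * l1) * m1 - l1 * (y0 * m0 + y1 * m1)).
    by ring.
  by rewrite Em mulr0 subr0.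
transitivity (- (y0 * l0 + y1 * l1) * m0 + l0 * (y0 * m0 + y1 * m1)).
  by ring.
by rewrite Em mulr0 addr0.
Qed.

Lemma m_neq0 p : U p -> exists k, m k p != 0.
Proof.
move=> Up; have := wedge_neq0 Up; rewrite wedgeE.
have [m0|m0] := eqVneq (m 0 p) 0; last by exists 0.
have [m1|m1] := eqVneq (m 1 p) 0; last by exists 1.
rewrite m0 m1; move: (ell_lo L 0 p) (ell_lo L 1 p) => l0 l1.
by rewrite !mulr0 subrr eqxx.
Qed.

(** In dimension two, covectors that kill y are proportional to m. *)
Lemma kernel_yc (b : 'I_2 -> R) p i j : U p ->
  \sum_i yc i p * b i = 0 -> b i * m j p = b j * m i p.
Proof.
move=> Up; rewrite sum_ord2 => E1; have [Y0 Y1] := yc_wedge Up.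
have E : b 0 * m 1 p = b 1 * m 0 p.
  move: E1 Y0 Y1 (metric_neq0 Up).
  move: (yc 0 p) (yc 1 p) (m 0 p) (m 1 p) (b 0) (b 1) (L p) (wedge L m p).
  move=> y0 y1 m0 m1 b0 b1 F w E1 Y0 Y1 F0.
  apply: (mulfI F0); apply/eqP; rewrite -subr_eq0; apply/eqP.
  transitivity (b0 * (F * m1) + b1 * (- F * m0)); first by ring.
  by rewrite -Y0 -Y1 -[RHS](mulr0 w) -E1; ring.
by case: (ord2P i) => ->; case: (ord2P j) => ->.
Qed.

Lemma frame_coords (b : 'I_2 -> R) p : U p ->
  exists s : R * R, forall i, b i = s.1 * ell_lo L i p + s.2 * m i p.
Proof.
move=> Up; have w0 := wedge_neq0 Up.
exists ((b 0 * m 1 p - b 1 * m 0 p) / wedge L m p,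
  (ell_lo L 0 p * b 1 - ell_lo L 1 p * b 0) / wedge L m p) => i /=.
move: w0; rewrite wedgeE; case: (ord2P i) => ->;
  move: (ell_lo L 0 p) (ell_lo L 1 p) (m 0 p) (m 1 p) (b 0) (b 1);
  by move=> ? ? ? ? ? ? w0; field.
Qed.

Lemma vderP f p i : U p ->
  L p * dy i f p = (vder L m f p).1 * ell_lo L i p + (vder L m f p).2 * m i p.
Proof.
by move=> Up; rewrite vderE; apply: (getPex (frame_coords (fun i => L p * dy i f p) Up)).
Qed.

Lemma hderP f p i : U p ->
  delta L i f p = (hder L m f p).1 * ell_lo L i p + (hder L m f p).2 * m i p.
Proof.
by move=> Up; rewrite hderE; apply: (getPex (frame_coords (fun i => delta L i f p) Up)).
Qed.

Lemma g_lo_sym i j p : U p -> g_lo L i j p = g_lo L j i p.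
Proof.
move=> Up; rewrite (fc_metric fc i j Up) (fc_metric fc j i Up).
move: (ell_lo L i p) (ell_lo L j p) (m i p) (m j p) => li lj mi mj.
by ring.
Qed.

Lemma C_lo_sym i j k p : U p -> C_lo L i j k p = C_lo L j i k p.
Proof.
move=> Up; have H : dy k (g_lo L i j) p = dy k (g_lo L j i) p.
  apply: near_eq_derive.
  by apply: filterS (near_open oU Up) => q; exact: g_lo_sym.
by rewrite !C_loE; have := congr1 (fun x : R => 2^-1 * x) H.
Qed.

Lemma C_lo_yc3 i j p : U p -> \sum_k yc k p * C_lo L i j k p = 0.
Proof.
move=> Up; have D := smooth_on_differentiable (g_lo_smooth i j) Up.
have E k : yc k p * C_lo L i j k p = 2^-1 * (p.2 0 k * dy k (g_lo L i j) p).
  by rewrite C_loE mulrCA.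
rewrite (eq_bigr _ (fun k _ => E k)) -mulr_sumr -(derive_fiber p.2 D).
by rewrite (euler oU (g_lo_homogeneous i j) Up) mul0r mulr0.
Qed.

Lemma yc_diff i p : differentiable (yc i) p.
Proof.
apply: (@differentiable_comp _ _ _ _ (fun q : E => q.2) (fun y : 'rV[R]_2 => y 0 i)).
  by apply: linear_differentiable => q; exact: cvg_snd.
exact: differentiable_coord.
Qed.

Lemma dy_yc i k p : dy k (yc i) p = (k == i)%:R.
Proof.
have -> : dy k (yc i) p = 'D_((delta_mx 0 k : 'rV[R]_2) 0 i) id (yc i p).
  by apply: (derive_change _).1 => h; rewrite ycE !mxE.
by rewrite derive_id mxE eqxx /= eq_sym.
Qed.

(** Differentiate g_ij y^i = dy_j F^2 / 2.  The third derivatives of F^2 need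
    not be permuted: symmetry in the first two indices comes from the frame. *)
Lemma C_lo_yc1 j k p : U p -> \sum_i yc i p * C_lo L i j k p = 0.
Proof.
move=> Up; rewrite sum_ord2.
have Dg i : differentiable (g_lo L i j) p.
  exact: smooth_on_differentiable (g_lo_smooth i j) Up.
have Dy i : differentiable (fun q => yc i q * g_lo L i j q) p.
  by apply: differentiableM; [exact: yc_diff|exact: Dg].
have E i : dy k (fun q => yc i q * g_lo L i j q) p =
    yc i p * dy k (g_lo L i j) p + g_lo L i j p * (k == i)%:R.
  by rewrite -(dy_yc i k p); exact: derive_mul (yc_diff i p) (Dg i).
have Ek : dy k (fun q => yc 0 q * g_lo L 0 j q + yc 1 q * g_lo L 1 j q) p
    = g_lo L k j p.
  have Dd : differentiable (dy j (sqrF L)) p.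
    apply: smooth_on_differentiable Up.
    by apply: smooth_on_dy; exact: sqrF_smooth.
  have -> : g_lo L k j p = dy k (fun q => 2^-1 * dy j (sqrF L) q) p.
    by rewrite g_loE; exact/esym/derive_scale.
  apply: near_eq_derive; apply: filterS (near_open oU Up) => q Uq.
  have := g_lo_yc j Uq; rewrite sum_ord2 => ->.
  by rewrite dy_sqrF //; move: (L q) (ell_lo L j q) => a b; field.
have ED : dy k (fun q => yc 0 q * g_lo L 0 j q + yc 1 q * g_lo L 1 j q) p =
    dy k (fun q => yc 0 q * g_lo L 0 j q) p
    + dy k (fun q => yc 1 q * g_lo L 1 j q) p by exact: derive_add.
have C i : C_lo L i j k p = 2^-1 * dy k (g_lo L i j) p by rewrite C_loE.
rewrite (C 0) (C 1).
have := etrans (esym (congr2 (fun a b : R => a + b) (E 0) (E 1)))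
  (etrans (esym ED) Ek).
rewrite (ord2_delta (fun i => g_lo L i j p) k).
generalize (dy k (g_lo L 0 j) p) (dy k (g_lo L 1 j) p) => c0 c1.
generalize (yc 0 p) (yc 1 p) (g_lo L 0 j p) (g_lo L 1 j p) => y0 y1 g0 g1.
generalize ((k == 0)%:R : R) ((k == 1)%:R : R) => e0 e1 H.
have {}H : y0 * c0 + y1 * c1 = 0.
  by apply: (addIr (g0 * e0 + g1 * e1)); rewrite add0r -[RHS]H; ring.
by rewrite mulrCA [X in _ + X]mulrCA -mulrDr H mulr0.
Qed.

Lemma main_scalarP p i j k : U p ->
  L p * C_lo L i j k p = main_scalar L m p * m i p * m j p * m k p.
Proof.
move=> Up; have [l ml] := m_neq0 Up.
suff ex : exists s : R, forall i j k, L p * C_lo L i j k p = s * m i p * m j p * m k p.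
  by rewrite main_scalarE; move: i j k; exact: (getPex ex).
exists (L p * (C_lo L l l l p / m l p ^+ 3)) => {}i {}j {}k.
rewrite (@trilinear_rank1 _ _ (fun a b c => C_lo L a b c p) (m^~ p) l ml) /=.
- by rewrite !mulrA.
- by move=> a b c; exact: C_lo_sym.
- by move=> a b c d; exact: (kernel_yc a d Up (C_lo_yc1 b c Up)).
- by move=> a b c d; exact: (kernel_yc c d Up (C_lo_yc3 a b Up)).
Qed.

Lemma dy_ell i k p : U p -> L p * dy k (ell_lo L i) p = eps * m k p * m i p.
Proof.
move=> Up; have Dl := smooth_on_differentiable (ell_smooth i) Up.
have E0 : dy k (dy i (sqrF L)) p = dy k (fun q => 2 * (L q * ell_lo L i q)) p.
  apply: near_eq_derive; apply: filterS (near_open oU Up) => q.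
  exact: dy_sqrF.
have DM := differentiableM (metric_diff Up) Dl.
have E1 := etrans E0 (etrans (dyZ k 2 DM) (congr1 _ (dyM k (metric_diff Up) Dl))).
have E2 : g_lo L k i p = 2^-1 * dy k (dy i (sqrF L)) p by rewrite g_loE.
have := etrans (esym (fc_metric fc k i Up)) (etrans E2 (congr1 _ E1)).
rewrite -(ell_loE L k).
generalize (L p) (dy k (ell_lo L i) p) (ell_lo L i p) (ell_lo L k p).
generalize (m i p) (m k p) => mi mk F d li lk H.
by apply: (addrI (lk * li)); rewrite H; field.
Qed.

Lemma dy_m i k p : U p ->
  L p * dy k (m i) p = (eps * main_scalar L m p * m i p - ell_lo L i p) * m k p.
Proof.
move=> Up.
have Dl j := smooth_on_differentiable (ell_smooth j) Up.
have Dm j := fc_diff fc j Up.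
have H a b : main_scalar L m p * m a p * m b p * m k p =
   2^-1 * (ell_lo L a p * (eps * m k p * m b p)
   + ell_lo L b p * (eps * m k p * m a p)
   + eps * (m a p * (L p * dy k (m b) p) + m b p * (L p * dy k (m a) p))).
  have E0 : dy k (g_lo L a b) p = dy k (fun q => ell_lo L a q * ell_lo L b q
      + eps * (m a q * m b q)) p.
    apply: near_eq_derive; apply: filterS (near_open oU Up) => q Uq.
    by rewrite (fc_metric fc a b Uq) mulrA.
  have D1 := differentiableM (Dm a) (Dm b).
  have D2 := differentiableM (Dl a) (Dl b).
  have E1 := etrans (dyD k D2 (differentiable_scale eps D1)) (congr2 +%R
    (dyM k (Dl a) (Dl b)) (etrans (dyZ k eps D1) (congr1 _ (dyM k (Dm a) (Dm b))))).
  have E2 : C_lo L a b k p = 2^-1 * dy k (g_lo L a b) p by rewrite C_loE.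
  have E3 := etrans E2 (congr1 (fun x : R => 2^-1 * x) (etrans E0 E1)).
  rewrite -(main_scalarP a b k Up) E3 -(dy_ell a k Up) -(dy_ell b k Up).
  generalize (L p) (ell_lo L a p) (ell_lo L b p) (m a p) (m b p).
  generalize (dy k (ell_lo L a) p) (dy k (ell_lo L b) p).
  generalize (dy k (m a) p) (dy k (m b) p) => *.
  by ring.
apply: (@frame_derivative R 'I_2 (m^~ p) (ell_lo L ^~ p)
  (fun j => L p * dy k (m j) p) _ eps (m k p) frame_sign_sqr (m_neq0 Up) H).
Qed.

(** m is homogeneous of degree 0, in infinitesimal form. *)
Lemma m_radial i p : U p -> 'D_((0, p.2) : E) (m i) p = 0.
Proof.
move=> Up; rewrite (derive_fiber _ (fc_diff fc i Up)).
apply: (mulfI (metric_neq0 Up)); rewrite mulr0 mulr_sumr.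
have E k : L p * (p.2 0 k * dy k (m i) p) =
    (eps * main_scalar L m p * m i p - ell_lo L i p) * (yc k p * m k p).
  by rewrite mulrCA (dy_m i k Up) mulrCA ycE.
by rewrite (eq_bigr _ (fun k _ => E k)) -mulr_sumr m_yc // mulr0.
Qed.

(** Near a point where m_l does not vanish, I = F C_lll / m_l^3. *)
Lemma main_scalar_diff p : U p -> differentiable (main_scalar L m) p.
Proof.
move=> Up; have [l ml] := m_neq0 Up.
have nl : \forall q \near p, m l q != 0.
  have /differentiable_continuous := fc_diff fc l Up.
  by move/cvgr_neq0; exact.
apply: (@near_eq_differentiable _ _ _ (fun q => L q * C_lo L l l l q *
    (m l q * m l q * m l q)^-1)).
  near=> q; have Uq : U q by near: q; exact: (near_open oU Up).
  rewrite (main_scalarP l l l Uq).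
  have : m l q != 0 by near: q.
  by generalize (m l q) (main_scalar L m q) => a b a0; field.
have Dm := fc_diff fc l Up; have DC := smooth_on_differentiable (C_lo_smooth l l l) Up.
apply: differentiableM (differentiableM (metric_diff Up) DC) _.
apply: differentiableV (differentiableM (differentiableM Dm Dm) Dm) _.
by rewrite !mulf_neq0.
Unshelve. all: by end_near. Qed.

(** I is homogeneous of degree 0, in infinitesimal form. *)
Lemma main_scalar_radial p : U p -> 'D_((0, p.2) : E) (main_scalar L m) p = 0.
Proof.
move=> Up; have [l ml] := m_neq0 Up.
have Dm := fc_diff fc l Up.
have DI := main_scalar_diff Up.
have H : fiber_homogeneous U 0 (fun q => L q * C_lo L l l l q).
  move=> q t Uq t0.
  rewrite (fc_homogeneous fc Uq t0) (C_lo_homogeneous l l l Uq t0).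
  rewrite powRr0 powRN powRr1 ?ltW //.
  move: (gt_eqF t0) => /negbT; generalize (L q) (C_lo L l l l q) => a b t1.
  by field.
have E0 := euler oU H Up; rewrite mul0r in E0.
have E1 : 'D_((0, p.2) : E) (fun q => L q * C_lo L l l l q) p =
    'D_((0, p.2) : E) (fun q => main_scalar L m q * (m l q * m l q * m l q)) p.
  apply: near_eq_derive; apply: filterS (near_open oU Up) => q Uq.
  by rewrite (main_scalarP l l l Uq) !mulrA.
have D2 : differentiable (fun q => m l q * m l q) p by exact: differentiableM.
have D3 : differentiable (fun q => m l q * m l q * m l q) p.
  exact: differentiableM.
have E2 : 'D_((0, p.2) : E) (fun q => m l q * m l q) p = 0.
  by rewrite (derive_mul _ Dm Dm) (m_radial l Up) !mulr0 addr0.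
have E3 : 'D_((0, p.2) : E) (fun q => m l q * m l q * m l q) p = 0.
  by rewrite (derive_mul _ D2 Dm) (m_radial l Up) E2 !mulr0 addr0.
have := etrans (esym E1) E0; rewrite (derive_mul _ DI D3) E3 mulr0 add0r.
by move/eqP; rewrite !mulf_eq0 (negPf ml) => /eqP.
Qed.

End Theory.
End FrameChart.

(** * Flat main scalars of Landsberg surfaces *)

Section Core.
Variable R : realType.
Local Notation E := ('rV[R]_2 * 'rV[R]_2)%type.
Variables (U : set E) (L : E -> R) (eps : R) (m : 'I_2 -> E -> R).
Hypothesis fc : frame_chart U L eps m.
Let oU := fc_open fc.
Implicit Types (p : E) (f : E -> R) (i j k r : 'I_2).

(** Raising an index solves the linear system with matrix g. *)
Lemma g_up_solve (b u : 'I_2 -> R) p i : U p ->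
  (forall j, b j = \sum_k g_lo L j k p * u k) -> \sum_j g_up L i j p * b j = u i.
Proof.
move=> Up H.
have := congr1 (fun B : 'cV[R]_2 => B i 0)
  (mulKmx (fc_unit fc Up) (\col_k u k)).
rewrite !mxE => <-; apply: eq_bigr => j _; congr (_ * _).
by rewrite H !mxE; apply: eq_bigr => k _; rewrite !mxE.
Qed.

(** The contravariant components of m expressed by those of ell. *)
Lemma m_up_wedge p : U p ->
  m_up L m 0 p * wedge L m p = - eps * ell_lo L 1 p /\
  m_up L m 1 p * wedge L m p = eps * ell_lo L 0 p.
Proof.
move=> Up; have w0 := wedge_neq0 fc Up.
pose u (i : 'I_2) := if i == 0 then - eps * ell_lo L 1 p / wedge L m p
   else eps * ell_lo L 0 p / wedge L m p.
have H j : m j p = \sum_k g_lo L j k p * u k.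
  rewrite sum_ord2 (fc_metric fc j 0 Up) (fc_metric fc j 1 Up) /u eqxx.
  rewrite (negPf (oner_neq0 _)).
  move: w0; rewrite wedgeE.
  have e2 := frame_sign_sqr fc; move: (m j p) (ell_lo L j p) => mj lj.
  generalize (ell_lo L 0 p) (ell_lo L 1 p) (m 0 p) (m 1 p) => l0 l1 m0 m1 w0.
  transitivity (eps * eps * mj); first by rewrite e2 mul1r.
  by field.
have S i : m_up L m i p = u i := g_up_solve i Up H.
rewrite !S /u eqxx (negPf (oner_neq0 _)).
by generalize (wedge L m p) w0 => w w0'; split; field.
Qed.

Lemma T_upE i j k r p : T_up L m i j k r p =
  m_up L m i p * (vder2 L m (main_scalar L m) p * m j p * m k p * m r p / L p).
Proof.
rewrite /T_up /m_up mulr_suml; apply: eq_bigr => n _; rewrite /T_lo.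
generalize (g_up L i n p) (m n p) (m j p) (m k p) (m r p) (L p)^-1 => *; ring.
Qed.

Lemma C_upE i j k p : U p -> C_up L i j k p =
  m_up L m i p * (main_scalar L m p * m j p * m k p / L p).
Proof.
move=> Up; rewrite /C_up /m_up mulr_suml; apply: eq_bigr => n _.
have := main_scalarP fc n j k Up; have := metric_neq0 fc Up.
generalize (g_up L i n p) (C_lo L n j k p) (main_scalar L m p) (m n p) (m j p).
generalize (m k p) (L p) => mk F g c s mn mj F0 H.
apply: (mulfI F0); rewrite mulrCA H; by field.
Qed.

Lemma phiT_vder2 f p : U p ->
  (forall j k r, \sum_i dx i f p * T_up L m i j k r p = 0) ->
  m_dx L m f p != 0 -> vder2 L m (main_scalar L m) p = 0.
Proof.
move=> Up H d0; have [l ml] := m_neq0 fc Up.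
have := H l l l; under eq_bigr do rewrite T_upE mulrA [dx _ _ _ * _]mulrC.
rewrite -mulr_suml -/(m_dx L m f p) => /eqP.
rewrite !mulf_eq0 (negPf d0) (negPf ml) invr_eq0 (negPf (metric_neq0 fc Up)) !orbF /=.
by move/eqP.
Qed.

Lemma vder1_radial f p : U p -> differentiable f p -> 'D_((0, p.2) : E) f p = 0 ->
  (vder L m f p).1 = 0.
Proof.
move=> Up Df; rewrite (derive_fiber _ Df) => H.
have L0 := metric_neq0 fc Up; apply: (mulIf L0); rewrite mul0r.
have H' : \sum_i yc i p * (L p * dy i f p) = 0.
  have E1 i : yc i p * (L p * dy i f p) = L p * (p.2 0 i * dy i f p).
    by rewrite mulrCA ycE.
  by rewrite (eq_bigr _ (fun i _ => E1 i)) -mulr_sumr H mulr0.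
rewrite sum_ord2 in H'; move: H' (vderP fc f 0 Up) (vderP fc f 1 Up).
generalize (dy 0 f p) (dy 1 f p) => d0 d1.
have := ell_yc fc Up; rewrite sum_ord2; have := m_yc fc Up; rewrite sum_ord2.
generalize (yc 0 p) (yc 1 p) (ell_lo L 0 p) (ell_lo L 1 p) (m 0 p) (m 1 p) (L p).
generalize (vder L m f p).1 (vder L m f p).2.
move=> a b y0 y1 l0 l1 m0 m1 F Em <- Ev V0 V1.
transitivity (y0 * (a * l0 + b * m0) + y1 * (a * l1 + b * m1)
  - b * (y0 * m0 + y1 * m1)); first by ring.
by rewrite -V0 -V1 Ev Em mulr0 subrr.
Qed.

Lemma dy_eq0 f p i : U p -> differentiable f p -> 'D_((0, p.2) : E) f p = 0 ->
  vder2 L m f p = 0 -> dy i f p = 0.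
Proof.
move=> Up Df H1 H2; apply: (mulfI (metric_neq0 fc Up)).
rewrite (vderP fc f i Up) (vder1_radial Up Df H1).
by rewrite -[(vder _ _ _ _).2]/(vder2 L m f p) H2 !mul0r addr0 mulr0.
Qed.

(** If the main scalar has no vertical derivative and F is Landsberg, then
    I_,2 = 0. *)
Lemma landsberg_hder2 p :
  (forall q, U q -> vder2 L m (main_scalar L m) q = 0) ->
  (forall q, U q -> hder1 L m (main_scalar L m) q = 0) ->
  U p -> hder2 L m (main_scalar L m) p = 0.
Proof.
set I := main_scalar L m => V0 H0 Up.
have DI q : U q -> differentiable I q by exact: (main_scalar_diff fc).
have dy0 q j : U q -> dy j I q = 0.
  move=> Uq; apply: dy_eq0 => //; [exact: DI|exact: (main_scalar_radial fc Uq)|exact: V0].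
have dxE q i : U q -> dx i I q = hder2 L m I q * m i q.
  move=> Uq; have := hderP fc I i Uq.
  rewrite -[(hder L m I q).1]/(hder1 L m I q) H0 // mul0r add0r => <-.
  by rewrite /delta big1 ?subr0 // => j _; rewrite dy0 // mulr0.
have dx_yc q : U q -> \sum_i yc i q * dx i I q = 0.
  move=> Uq; have E1 i : yc i q * dx i I q = hder2 L m I q * (yc i q * m i q).
    by rewrite dxE // mulrCA.
  by rewrite (eq_bigr _ (fun i _ => E1 i)) -mulr_sumr (m_yc fc Uq) mulr0.
have dx0 i : dx i I p = 0.
  have nU : \forall y \near p.2, U (p.1, y).
    have [[B C] /= [nB nC] BC] := near_open oU Up.
    by apply: filterS nC => y Cy; apply: BC; split=> //=; exact: nbhs_singleton nB.
  have n0 := dx_locally_cst 0 oU DI dy0 Up.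
  have n1 := dx_locally_cst 1 oU DI dy0 Up.
  (* The linear form y' |-> y'^i dx_i I(p) vanishes for all y' near y; its
     derivative along e_i is dx_i I(p). *)
  pose h (y : 'rV[R]_2) := y 0 0 * dx 0 I p + y 0 1 * dx 1 I p.
  have h0 : \forall y \near p.2, h y = 0.
    apply: filterS3 nU n0 n1 => y Uy.
    have := dx_yc _ Uy; rewrite sum_ord2 !ycE /h.
    generalize (dx 0 I (p.1, y)) (dx 1 I (p.1, y)) (dx 0 I p) (dx 1 I p).
    by move=> a b c d H <- <-.
  have <- : 'D_(dx i I p) id (h p.2) = dx i I p by rewrite derive_id.
  rewrite -(derive_cst (0 : R) p.2 (delta_mx 0 i : 'rV[R]_2)).
  rewrite -(near_eq_derive (delta_mx 0 i : 'rV[R]_2) h0).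
  apply/esym/(derive_change _).1 => t.
  rewrite /h !mxE eqxx /=; rewrite (ord2_delta (fun j => dx j I p) i).
  rewrite ![_ == i]eq_sym /GRing.scale /=.
  generalize (dx 0 I p) (dx 1 I p) (p.2 0 0) (p.2 0 1) => a b y0 y1.
  by generalize ((i == 0)%:R : R) ((i == 1)%:R : R) => e0 e1; ring.
have [l ml] := m_neq0 fc Up.
by apply: (mulIf ml); rewrite -dxE // dx0 mul0r.
Qed.
End Core.

(** * The frame of a conformally changed metric *)

(** The expression e^phi L of the changed metric in a chart. *)
Definition conformal_metric (R : realType) (phi L : 'rV[R]_2 * 'rV[R]_2 -> R) :=
  fun p => expR (phi p) * L p.

(** The frame covector of the changed metric in a chart. *)
Definition conformal_frame (R : realType) (L : 'rV[R]_2 * 'rV[R]_2 -> R)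
    (eps : R) (m : 'I_2 -> 'rV[R]_2 * 'rV[R]_2 -> R)
    (phi : 'rV[R]_2 * 'rV[R]_2 -> R) (i : 'I_2) :=
  fun p => expR (phi p) * Num.sqrt (eps / rho L m eps phi p) * m i p.

Section Conformal.
Variable R : realType.
Local Notation E := ('rV[R]_2 * 'rV[R]_2)%type.
Variables (U : set E) (L : E -> R) (eps : R) (m : 'I_2 -> E -> R) (phi : E -> R).
Hypothesis fc : frame_chart U L eps m.
Hypothesis phi_smooth : smooth_on U phi.
Hypothesis phi_homogeneous : fiber_homogeneous U 0 phi.
Hypothesis rho_sign : forall p, U p -> 0 < eps / rho L m eps phi p.
Let oU := fc_open fc.
Implicit Types (p q : E) (i j k : 'I_2).

Local Notation Lb := (conformal_metric phi L).
Local Notation mb := (conformal_frame L eps m phi).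
Local Notation P2 := (vder2 L m phi).

Lemma phi_diff p : U p -> differentiable phi p.
Proof. exact: smooth_on_differentiable. Qed.

(** As phi is homogeneous of degree 0, phi_;1 = 0. *)
Lemma phi_dy i p : U p -> L p * dy i phi p = P2 p * m i p.
Proof.
move=> Up; rewrite (vderP fc phi i Up) (vder1_radial fc Up (phi_diff Up)).
  by rewrite mul0r add0r.
by rewrite (euler oU phi_homogeneous Up) mul0r.
Qed.

Lemma expR_phi_diff p : U p -> differentiable (fun q => expR (phi q)) p.
Proof.
apply: smooth_on_differentiable; exact: smooth_on_expR.
Qed.

Lemma ell_conformal i p : U p ->
  ell_lo Lb i p = expR (phi p) * (ell_lo L i p + P2 p * m i p).
Proof.
move=> Up.
have H := dyM i (expR_phi_diff Up) (metric_diff fc Up).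
have H2 : dy i (fun q => expR (phi q)) p = expR (phi p) * dy i phi p.
  exact: derive_expRf (phi_diff Up).
rewrite ell_loE H H2 -(phi_dy i Up) -(ell_loE L i).
by generalize (dy i phi p) (ell_lo L i p) (L p) => *; ring.
Qed.

Lemma vder2_diff p : U p -> differentiable P2 p.
Proof.
move=> Up; have [l ml] := m_neq0 fc Up.
have nl : \forall q \near p, m l q != 0.
  have /differentiable_continuous := fc_diff fc l Up.
  by move/cvgr_neq0; exact.
apply: (@near_eq_differentiable _ _ _ (fun q => L q * dy l phi q * (m l q)^-1)).
  apply: filterS2 (near_open oU Up) nl => q Uq mq.
  by rewrite (phi_dy l Uq) mulfK.
have Dp := smooth_on_differentiable (smooth_on_dy l phi_smooth) Up.
apply: differentiableM (differentiableM (metric_diff fc Up) Dp) _.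
exact: differentiableV (fc_diff fc l Up) ml.
Qed.

Lemma vder2_radial p : U p -> 'D_((0, p.2) : E) P2 p = 0.
Proof.
move=> Up; have [l ml] := m_neq0 fc Up.
have Dm := fc_diff fc l Up.
have H : fiber_homogeneous U 0 (fun q => L q * dy l phi q).
  have D1 q : U q -> differentiable phi q by exact: phi_diff.
  have dh := dy_homogeneous l oU (fc_cone fc) D1 phi_homogeneous.
  move=> q t Uq t0; rewrite (fc_homogeneous fc Uq t0) (dh q t Uq t0).
  rewrite sub0r powRr0 powRN powRr1 ?ltW //.
  move: (gt_eqF t0) => /negbT; generalize (L q) (dy l phi q) => a b t1.
  by field.
have E0 := euler oU H Up; rewrite mul0r in E0.
have E1 : 'D_((0, p.2) : E) (fun q => L q * dy l phi q) p =
    'D_((0, p.2) : E) (fun q => P2 q * m l q) p.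
  by apply: near_eq_derive; apply: filterS (near_open oU Up) => q; exact: phi_dy.
have := etrans (esym E1) E0; rewrite (derive_mul _ (vder2_diff Up) Dm).
rewrite (m_radial fc l Up) mulr0 add0r.
by move/eqP; rewrite mulf_eq0 (negPf ml) => /eqP.
Qed.

Lemma vder2_dy i p : U p -> L p * dy i P2 p = vder2 L m P2 p * m i p.
Proof.
move=> Up; rewrite (vderP fc P2 i Up) (vder1_radial fc Up (vder2_diff Up)).
  by rewrite mul0r add0r.
exact: vder2_radial.
Qed.

Lemma conformal_metric_smooth : smooth_on U Lb.
Proof. by apply: smooth_onM => //; [exact: smooth_on_expR|exact: (fc_smooth fc)]. Qed.

Lemma g_conformal i j p : U p -> g_lo Lb i j p =
  ell_lo Lb i p * ell_lo Lb j p
  + expR (phi p) ^+ 2 * (rho L m eps phi p)^-1 * m i p * m j p.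
Proof.
move=> Up; pose Z q := ell_lo L j q + P2 q * m j q.
have Dl := smooth_on_differentiable (ell_smooth fc j) Up.
have Dm := fc_diff fc j Up.
have DP := vder2_diff Up.
have DZ : differentiable Z p by apply: differentiableD => //; exact: differentiableM.
have DX := differentiableM (expR_phi_diff Up) DZ.
have DL := smooth_on_differentiable conformal_metric_smooth Up.
have E0 : dy i (dy j (sqrF Lb)) p =
    dy i (fun q => 2 * (Lb q * (expR (phi q) * Z q))) p.
  apply: near_eq_derive; apply: filterS (near_open oU Up) => q Uq.
  have DLq := smooth_on_differentiable conformal_metric_smooth Uq.
  rewrite sqrFE (dyM j DLq DLq) -(ell_loE Lb j) (ell_conformal j Uq).
  by generalize (Lb q) (expR (phi q)) => *; rewrite /Z; ring.
have E1 : dy i (fun q => 2 * (Lb q * (expR (phi q) * Z q))) p =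
    2 * (Lb p * dy i (fun q => expR (phi q) * Z q) p
      + expR (phi p) * Z p * dy i Lb p).
  exact: etrans (dyZ i 2 (differentiableM DL DX)) (congr1 _ (dyM i DL DX)).
have E2 : dy i (fun q => expR (phi q) * Z q) p =
    expR (phi p) * dy i Z p + Z p * (expR (phi p) * dy i phi p).
  have H := dyM i (expR_phi_diff Up) DZ.
  have H2 : dy i (fun q => expR (phi q)) p = expR (phi p) * dy i phi p.
    exact: derive_expRf (phi_diff Up).
  by rewrite H H2.
have E3 : dy i Z p = dy i (ell_lo L j) p
    + (P2 p * dy i (m j) p + m j p * dy i P2 p).
  have H := dyD i Dl (differentiableM DP Dm).
  by rewrite H (dyM i DP Dm).
have E4 : g_lo Lb i j p = 2^-1 * dy i (dy j (sqrF Lb)) p by rewrite g_loE.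
have := etrans E4 (congr1 (fun x : R => 2^-1 * x) (etrans E0 E1)).
rewrite E2 E3 -(ell_loE Lb i) => ->.
rewrite (ell_conformal i Up) (ell_conformal j Up) /Z /rho invrK /sigma.
have := vder2_dy i Up; have := phi_dy i Up; have := dy_ell fc j i Up.
have := dy_m fc j i Up; rewrite /conformal_metric.
generalize (dy i (ell_lo L j) p) (dy i (m j) p) (dy i P2 p) (dy i phi p).
generalize (vder2 L m P2 p) (P2 p) (main_scalar L m p) (expR (phi p)).
generalize (m i p) (m j p) (ell_lo L i p) (ell_lo L j p) (L p).
move=> mi mj li lj F P22 P s e dl dm dP dphi H1 H2 H3 H4.
transitivity (e * (e * (F * dl + (P * (F * dm) + mj * (F * dP)))
   + (lj + P * mj) * (e * (F * dphi))) + e * (lj + P * mj) * (e * (li + P * mi))).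
  by field.
by rewrite H1 H2 H3 H4; ring.
Qed.

Local Notation sq p := (Num.sqrt (eps / rho L m eps phi p)).

Lemma frame_conformal_metric i j p : U p -> g_lo Lb i j p =
  ell_lo Lb i p * ell_lo Lb j p + eps * mb i p * mb j p.
Proof.
move=> Up; rewrite (g_conformal i j Up); congr (_ + _).
have := sqr_sqrtr (ltW (rho_sign Up)); have := frame_sign_sqr fc.
rewrite /conformal_frame; generalize (Num.sqrt (eps / rho L m eps phi p)).
generalize (rho L m eps phi p)^-1 (expR (phi p)) (m i p) (m j p).
move=> r e mi mj s e2 s2.
transitivity (eps * e ^+ 2 * s ^+ 2 * mi * mj); last by ring.
rewrite s2; transitivity (eps * eps * e ^+ 2 * r * mi * mj); last by ring.
by rewrite e2 mul1r.
Qed.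

Lemma wedge_conformal p : U p ->
  wedge Lb mb p = expR (phi p) ^+ 2 * sq p * wedge L m p.
Proof.
move=> Up; rewrite !wedgeE (ell_conformal 0 Up) (ell_conformal 1 Up) /conformal_frame.
generalize (Num.sqrt (eps / rho L m eps phi p)) (expR (phi p)) (P2 p).
generalize (ell_lo L 0 p) (ell_lo L 1 p) (m 0 p) (m 1 p) => *.
by ring.
Qed.

Lemma conformal_factor_gt0 p : U p -> 0 < sq p.
Proof. by move=> Up; rewrite sqrtr_gt0; exact: rho_sign. Qed.

(** The scalar rho contains second vertical derivatives of phi along m.  Its
    differentiability is read off from [g_conformal], which expresses it by the
    smooth functions gbar_ll and ellbar_l and by m_l. *)
Lemma conformal_frame_diff i p : U p -> differentiable (mb i) p.
Proof.
move=> Up; have [l ml] := m_neq0 fc Up.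
have nl : \forall q \near p, m l q != 0.
  have /differentiable_continuous := fc_diff fc l Up.
  by move/cvgr_neq0; exact.
pose h q := eps * ((g_lo Lb l l q - ell_lo Lb l q * ell_lo Lb l q)
   * (expR (phi q) * m l q * (expR (phi q) * m l q))^-1).
have hE q : U q -> m l q != 0 -> h q = eps / rho L m eps phi q.
  move=> Uq mq; rewrite /h (g_conformal l l Uq).
  have := expR_gt0 (phi q); rewrite lt0r => /andP[+ _]; move: mq.
  generalize (ell_lo Lb l q) (rho L m eps phi q)^-1 (expR (phi q)) (m l q).
  by move=> a r e ml' m0 e0; field; rewrite m0.
have Dh : differentiable h p.
  apply: differentiable_scale; apply: differentiableM.
    have D1 : differentiable (g_lo Lb l l) p.
      rewrite g_loE sqrFE; apply: differentiable_scale.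
      apply: smooth_on_differentiable Up; apply: smooth_on_dy; apply: smooth_on_dy.
      exact: smooth_onM conformal_metric_smooth conformal_metric_smooth.
    have D2 : differentiable (ell_lo Lb l) p.
      exact: smooth_on_differentiable (smooth_on_dy l conformal_metric_smooth) Up.
    by apply: differentiableB => //; exact: differentiableM.
  have D3 := differentiableM (expR_phi_diff Up) (fc_diff fc l Up).
  apply: differentiableV; first exact: differentiableM.
  by rewrite !mulf_neq0 // gt_eqF // expR_gt0.
apply: (@near_eq_differentiable _ _ _
   (fun q => expR (phi q) * Num.sqrt (h q) * m i q)).
  by apply: filterS2 (near_open oU Up) nl => q Uq mq; rewrite /conformal_frame hE.
apply: differentiableM; last exact: (fc_diff fc i Up).
apply: differentiableM; first exact: expR_phi_diff.
apply: (@differentiable_comp _ _ _ _ h Num.sqrt) => //.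
apply/derivable1_diffP; apply: ex_derive; apply: is_derive1_sqrt.
by rewrite hE // rho_sign.
Qed.

Lemma frame_chart_conformal : frame_chart U Lb eps mb.
Proof.
split.
- exact: oU.
- exact: (fc_cone fc).
- exact: (fc_neq0 fc).
- exact: conformal_metric_smooth.
- move=> p l Up l0; rewrite /conformal_metric (fc_homogeneous fc Up l0) (phi_homogeneous Up l0).
  by rewrite powRr0 mul1r mulrCA.
- move=> p Up; rewrite unitmxE unitfE.
  rewrite (det_frame (fun i j => frame_conformal_metric i j Up)).
  rewrite wedge_conformal // !mulf_neq0 ?(eps_neq0 fc) // ?(wedge_neq0 fc Up) //.
  all: try by rewrite gt_eqF // ?expR_gt0 // ?conformal_factor_gt0.
- exact: (fc_sign fc).
- by move=> p i; exact: conformal_frame_diff.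
- by move=> p i j; exact: frame_conformal_metric.
Qed.

(** mbar^i = (m^i - eps phi_;2 ell^i) / (e^phi sqrt (eps / rho)), contracted
    with d_i phi. *)
Lemma m_dx_conformal p : U p -> m_dx Lb mb phi p * (expR (phi p) * sq p) =
  m_dx L m phi p - eps * P2 p * ell_dx L phi p.
Proof.
move=> Up.
have [B0 B1] := m_up_wedge frame_chart_conformal Up.
have [A0 A1] := m_up_wedge fc Up.
have [Y0 Y1] := yc_wedge fc Up.
have L0 := metric_neq0 fc Up; have w0 := wedge_neq0 fc Up.
have e0 : expR (phi p) != 0 by rewrite gt_eqF // expR_gt0.
have s0 : sq p != 0 by rewrite gt_eqF // conformal_factor_gt0.
rewrite /m_dx /ell_dx !sum_ord2 /ell_up.
move: B0 B1 A0 A1 Y0 Y1 L0 w0 e0 s0.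
rewrite (wedge_conformal Up) (ell_conformal 0 Up) (ell_conformal 1 Up).
generalize (m_up Lb mb 0 p) (m_up Lb mb 1 p) (m_up L m 0 p) (m_up L m 1 p).
generalize (dx 0 phi p) (dx 1 phi p) (yc 0 p) (yc 1 p) (wedge L m p) (sq p).
generalize (expR (phi p)) (P2 p) (L p).
generalize (ell_lo L 0 p) (ell_lo L 1 p) (m 0 p) (m 1 p).
move=> l0 l1 m0 m1 e P F d0 d1 y0 y1 w s b0 b1 a0 a1 B0 B1 A0 A1 Y0 Y1 F0 w0 e0 s0.
have {}B0 : b0 = - eps * (e * (l1 + P * m1)) / (e ^+ 2 * s * w).
  by rewrite -B0; field; rewrite e0 s0 w0.
have {}B1 : b1 = eps * (e * (l0 + P * m0)) / (e ^+ 2 * s * w).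
  by rewrite -B1; field; rewrite e0 s0 w0.
have {}A0 : a0 = - eps * l1 / w by rewrite -A0; field.
have {}A1 : a1 = eps * l0 / w by rewrite -A1; field.
have {}Y0 : y0 = F * m1 / w by rewrite -Y0; field.
have {}Y1 : y1 = - F * m0 / w by rewrite -Y1; field.
rewrite B0 B1 A0 A1 Y0 Y1; field.
by rewrite F0 w0 e0 s0.
Qed.
End Conformal.

(** * From charts to the surface *)

Section Charts.
Variables (R : realType) (M : smooth_surface R).
Implicit Types (A : set (tvec M)) (F phi : tvec M -> R) (a : chart_idx M).

(** Tangent vectors are determined by base point and components. *)
Lemma tvec_eq (u v : tvec M) :
  tv_pt u = tv_pt v -> tv_comp u = tv_comp v -> u = v.
Proof.
case: u v => [x c uc uo] [y d vc vo] /= xy cd; move: uc uo vc vo.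
rewrite xy cd => uc uo vc vo.
by rewrite (Prop_irrelevance uc vc) (Prop_irrelevance uo vo).
Qed.

Lemma tv_param_stretch a (l : R) p :
  tv_param a (stretch l p) = tv_scale l (tv_param a p).
Proof.
apply: tvec_eq => //; apply/funext => b; rewrite /= /tv_of_comp /=.
by case: ifP => _; rewrite ?linearZ ?scaler0.
Qed.

Lemma local_dom_neq0 A a p : conic_subbundle A -> local_dom A a p -> p.2 != 0.
Proof.
move=> cA [_ Ap]; apply/eqP => p0; have [b /eqP] := conic_neq0 cA Ap.
by apply; rewrite /= /tv_of_comp p0 linear0; case: ifP.
Qed.

Lemma local_dom_stretch A a p (l : R) : conic_subbundle A -> 0 < l ->
  local_dom A a p -> local_dom A a (stretch l p).
Proof.
move=> cA l0 [pa Ap]; split=> //; rewrite tv_param_stretch.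
exact: conic_scale.
Qed.

Lemma local_fun_homogeneous A (r : nat) F a : homogeneous_fun A r F ->
  fiber_homogeneous (local_dom A a) r%:R (local_fun F a).
Proof.
move=> hF p l [_ Ap] l0; rewrite /local_fun /= tv_param_stretch hF //.
by rewrite powR_mulrn // ltW.
Qed.

Lemma local_frame_chart A F eps (m : chart_idx M -> 'I_2 -> 'rV[R]_2 * 'rV[R]_2 -> R) a :
  conic_pseudo_finsler A F -> berwald_frame A F eps m ->
  frame_chart (local_dom A a) (local_fun F a) eps (m a).
Proof.
move=> [cA sF hF nF] [se sm gm]; split => //.
- exact: conic_open.
- by move=> p l Ap l0; exact: local_dom_stretch.
- by move=> p; exact: local_dom_neq0.
- exact: local_fun_homogeneous hF.
- by move=> p; exact: nF.
- by move=> p i; apply: smooth_on_differentiable; exact: sm.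
- by move=> p i j; exact: gm.
Qed.

(** Part (i), for any metric and frame that are well behaved in every chart. *)
Lemma landsberg_phiT_berwaldian A F phi eps
    (m : chart_idx M -> 'I_2 -> 'rV[R]_2 * 'rV[R]_2 -> R) :
  (forall a, frame_chart (local_dom A a) (local_fun F a) eps (m a)) ->
  landsberg A F m -> phiT_condition A F m phi ->
  (forall a p, local_dom A a p ->
     m_dx (local_fun F a) (m a) (local_fun phi a) p != 0) ->
  berwaldian A F m.
Proof.
move=> fc HL HT Hm a p Ap; split; first exact: HL.
apply: (landsberg_hder2 (fc a)) (Ap) => q Aq; last exact: HL.
by apply: (phiT_vder2 (fc a) Aq _ (Hm a q Aq)) => j k r; exact: HT.
Qed.

End Charts.

Theorem theorem4p5 (R : realType) (M : smooth_surface R) (A : set (tvec M))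
    (F phi : tvec M -> R) (eps : R)
    (m : chart_idx M -> 'I_2 -> 'rV[R]_2 * 'rV[R]_2 -> R)
    (finslerF : conic_pseudo_finsler A F)
    (frameF : berwald_frame A F eps m)
    (changeF : anisotropic_conformal A F eps m phi) :
  let Fbar := aniso_metric F phi in
  let mbar := aniso_frame F eps m phi in
  (* (i) *)
  (landsberg A F m ->
   phiT_condition A F m phi ->
   (forall a p, local_dom A a p ->
      m_dx (local_fun F a) (m a) (local_fun phi a) p != 0) ->
   berwaldian A F m) /\
  (* (ii) *)
  (same_frame_sign A F eps m phi ->
   (landsberg A Fbar mbar ->
    phiT_condition A Fbar mbar phi ->
    (forall a p, local_dom A a p ->
       m_dx (local_fun F a) (m a) (local_fun phi a) p !=
       eps * vder2 (local_fun F a) (m a) (local_fun phi a) p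
         * ell_dx (local_fun F a) (local_fun phi a) p) ->
    berwaldian A Fbar mbar) /\
   (~ riemannian A Fbar mbar ->
    landsberg A Fbar mbar ->
    phiT_condition A Fbar mbar phi ->
    (forall a p, local_dom A a p -> ~ C_anisotropic_at Fbar phi a p) ->
    berwaldian A Fbar mbar)).
Proof.
move=> Fbar mbar.
have fc a := local_frame_chart a finslerF frameF.
split; first by move=> ? ?; exact: landsberg_phiT_berwaldian fc _ _.
move=> rho_sign.
have sphi a := aniso_smooth changeF a.
have hphi a : fiber_homogeneous (local_dom A a) 0 (local_fun phi a).
  exact: (local_fun_homogeneous (aniso_homogeneous changeF)).
have fcb a : frame_chart (local_dom A a) (local_fun Fbar a) eps (mbar a).
  exact: (frame_chart_conformal (fc a) (sphi a) (hphi a) (rho_sign a)).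
split=> [HL HT Hm | _ HL HT HC]; apply: (landsberg_phiT_berwaldian fcb HL HT).
  move=> a p Ap; have := Hm a p Ap; rewrite -subr_eq0.
  rewrite -(m_dx_conformal (fc a) (sphi a) (hphi a) (rho_sign a) Ap).
  by rewrite mulf_eq0 negb_or => /andP[].
move=> a p Ap; apply/eqP => m0; apply: (HC a p Ap) => j k.
under eq_bigr do rewrite (C_upE (fcb a)) // mulrAC.
by rewrite -mulr_suml -/(m_dx _ _ _ _) m0 mul0r.
Qed.
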